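(* Let $s\in[0,1]$ and let $F=f$ satisfy the assumptions in the context (in particular $f$ is $\mu$-weakly convex and $\phi=0$, $h=0$). Run the smooth ACPP algorithm (described in the context) with starting point $x^0$, $K\ge1$ and $t$ inner iterations. Let $\kappa_s=\max_i\tilde L_i^s/\min_i\tilde L_i^s$, $T_{(1-s)/2}=\sum_{i=1}^m\tilde L_i^{(1-s)/2}$, $\tilde\mu_s=\mu/\tilde L_{\max}^s$, $\eta=\sqrt{\tilde\mu_s}/\bigl(\sqrt{\tilde\mu_s}+T_{(1-s)/2}\bigr)$, and assume that $\lambda=(1-\eta)^t<\frac12$. Then $$\mathbb{E}\|\nabla F(x^{\hat{k}})\|^{2}\le\frac{8\lambda L^{2}\kappa_{s}+16\mu^{2}\kappa_{s}}{K\mu(1-2\lambda)}\left[\mu\|x^{0}-x^{*}\|^{2}+2\lambda[F(x^{0})-F(x^{*})]\right].$$ In particular, if we set $t\ge\lceil-\eta^{-1}\ln\tilde\lambda\rceil$ with $\tilde\lambda=\min\{\frac18,\frac{\mu}{4L},\frac{\mu^2}{L^2}\}$, then, in order to guarantee that $\mathbb{E}\|\nabla F(x^{\hat k})\|^2\le\varepsilon$, the total number of block gradient updates is at most $$N_{\varepsilon}=\mathcal{O}\left(\Bigl(1+\tilde L_{\max}^{s}\,T_{(1-s)/2}/\sqrt{\tilde\mu_s}\Bigr)\log\left(\max\bigl\{8,\tfrac{4L}{\mu},\tfrac{L^{2}}{\mu^{2}}\bigr\}\right)\left(\frac{40\mu^2\kappa_{s}\|x^{0}-x^{*}\|^{2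}}{\varepsilon}+1\right)\right).$$
   Context: Notation. $[m]=\{1,\dots,m\}$. $d=\sum_{i=1}^m d_i$, and $U_i\in\mathbb{R}^{d\times d_i}$ are such that $[U_1,\dots,U_m]=I_d$. For $x\in\mathbb{R}^d$, $x_i=U_i^Tx\in\mathbb{R}^{d_i}$ is the $i$-th block; $\nabla_i f(x)=U_i^T\nabla f(x)$. $\|\cdot\|_i$ is the Euclidean norm on $\mathbb{R}^{d_i}$, $\|\cdot\|$ the Euclidean norm on $\mathbb{R}^d$. Assumptions. The problem is $\min_{x\in\mathbb{R}^d}F(x)=f(x)$, where: (i) $f:\mathbb{R}^d\to\mathbb{R}$ is continuously differentiable and block-wise Lipschitz smooth with constants $L_1,\dots,L_m>0$: $\|\nabla_i f(x)-\nabla_i f(x+U_it)\|_i\le L_i\|t\|_i$ for all $x\in\mathbb{R}^d$, $t\in\mathbb{R}^{d_i}$, $i\in[m]$; and $\|\nabla f(x)-\nabla f(y)\|\le L\|x-y\|$ for all $x,y$, with $L>0$; (ii) $f$ is $\mu$-weakly convex, $\mu>0$: $f(x)\ge f(y)+\langle\nabla f(y),x-y\rangle-\frac{\mu}{2}\|x-y\|^2$ for all $x,y$ (the setting of interest is the ill-conditioned one, $\mu\ll L_i$ for all $i\in[m]$); (iii) every lower level set $\{x:F(x)\le r\}$, $r\in\mathbb{R}$, is bounded; (iv) there is $x^*$ with $F(x^* )=\min_xF(x)>-\infty$. Constants: $\tilde L_i=L_i+2\mu$, $\tilde L_{\max}=\max_i\tilde L_i$. Smooth ACPP algorithm. Input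 $x^0,\mu,t,s$. For $k=0,1,\dots,K$: let $F_k(x)=F(x)+\mu\|x-x^k\|^2$, and let $x^{k+1}$ be the output of $t$ iterations of the ACD method below applied to $F_k$, started at $x^k$, with block constants $\tilde L_i$, parameter $s$ and strong convexity parameter $\tilde\mu_s$ (with respect to $\|x\|_{\widetilde{[s]}}=\sqrt{\sum_i\tilde L_i^s\|x_i\|_i^2}$), using samples independent of the past. Finally choose $\hat k$ uniformly at random from $\{2,3,\dots,K+1\}$, independently of everything else, and output $x^{\hat k}$. The expectation is over all randomness. ACD method (applied to a smooth convex function $q$ with block constants $\tilde L_i$, strong convexity parameter $\tilde\mu_s$, starting point $w^0$, $t$ iterations). Let $T=\sum_i\tilde L_i^{(1-s)/2}$, $p_i=\tilde L_i^{(1-s)/2}/T$, $\alpha=\frac{\sqrt{\tilde\mu_s}}{\sqrt{\tilde\mu_s}+T}$, $\beta=\sqrt{\tilde\mu_s}\,T$, $\gamma=\tilde\mu_s$, $z^0=w^0$. For $j=0,\dots,t-1$: set $y^j=(1-\alpha)w^j+\alpha z^j$; sample $i_j\in[m]$ (independently) with $\Pr(i_j=i)=p_i$; set $$z^{j+1}=\operatorname{argmin}_x\Bigl\{\langle\nabla_{i_j}q(y^j),x_{i_j}\rangle+\tfrac{p_{i_j}\gamma}{2}\|x-y^j\|_{\widetilde{[s]}}^2+\tfrac{p_{i_j}\beta}{2}\|x-z^j\|_{\widetilde{[s]}}^2\Bigr\},\qquad \bar w^{j+1}=y^j+\tfrac{\alpha}{p_{i_j}}U_{i_j}(z^{j+1}_{i_j}-z^j_{i_j});$$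 then either (Option I) $w^{j+1}_{i_j}=\operatorname{argmin}_{x\in\mathbb{R}^{d_{i_j}}}\{\langle\nabla_{i_j}q(\bar w^{j+1}),x\rangle+\frac{\tilde L_{i_j}}{2}\|x-\bar w^{j+1}_{i_j}\|_{i_j}^2\}$ and $w^{j+1}_l=\bar w^{j+1}_l$ for $l\ne i_j$, or (Option II) $w^{j+1}=\bar w^{j+1}$. The output is $w^t$.
   Formalization: The constant in O(.) may depend on a positive lower bound of L̃_max^s (universal if L̃_max^s ≥ 1); with a fully universal constant the printed bound fails when f, L_i, L, μ are scaled towards 0 with s > 0. *)

(* Defs.v *)
From HB Require Import structures.
From mathcomp Require Export all_boot all_order all_algebra.
From mathcomp Require Export all_classical all_reals all_analysis.
Export Order.TTheory GRing.Theory Num.Theory numFieldNormedType.Exports.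

Set Implicit Arguments.
Unset Strict Implicit.
Unset Printing Implicit Defensive.

Local Open Scope classical_set_scope.
Local Open Scope ring_scope.

(* The blocks are indexed by 'I_m.+1, so that there is at least one of them,
   and R^d is the space of columns of height \sum_i d i. *)
Notation bvec R d := ('cV[R]_(\sum_i d i)%N).

(* The norm that the library puts on columns is the sup norm, hence the
   separate Euclidean norm below; the topology is the same. *)
Definition dotv (R : realType) n (x y : 'cV[R]_n) : R := \sum_i x i 0 * y i 0.

Definition enorm (R : realType) n (x : 'cV[R]_n) : R := Num.sqrt (dotv x x).

Definition grad (R : realType) n (f : 'cV[R]_n -> R) (x : 'cV[R]_n) :
    'cV[R]_n :=
  \col_j 'D_(delta_mx j 0) f x.

Definition blockU (R : realType) m (d : 'I_m.+1 -> nat) (i : 'I_m.+1) :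
    'M[R]_((\sum_i d i)%N, d i) :=
  submxrow 1%:M i.
Arguments blockU {R m} d i.

Lemma mxrow_blockU (R : realType) m (d : 'I_m.+1 -> nat) :
  \mxrow_i blockU d i = 1%:M :> 'M[R]_((\sum_i d i)%N).
Proof. exact: submxrowK. Qed.

Definition blk (R : realType) m (d : 'I_m.+1 -> nat) (i : 'I_m.+1)
    (x : bvec R d) : 'cV[R]_(d i) :=
  (blockU d i)^T *m x.

Definition bgrad (R : realType) m (d : 'I_m.+1 -> nat) (f : bvec R d -> R)
    (i : 'I_m.+1) (x : bvec R d) : 'cV[R]_(d i) :=
  blk i (grad f x).

Definition wnorm (R : realType) m (d : 'I_m.+1 -> nat) (Lt : 'I_m.+1 -> R)
    (s : R) (x : bvec R d) : R :=
  Num.sqrt (\sum_i Lt i `^ s * enorm (blk i x) ^+ 2).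

Definition is_argmin (R : realType) (V : Type) (g : V -> R) (x : V) : Prop :=
  forall y, g x <= g y.

(* Unspecified when g has no minimizer; the functions minimized by the
   algorithm are strongly convex quadratics with a unique minimizer. *)
Definition argmin (R : realType) (V : pointedType) (g : V -> R) : V :=
  get [set x | is_argmin g x].

Definition weakly_convex (R : realType) n (mu : R) (f : 'cV[R]_n -> R) : Prop :=
  forall x y,
    f x >= f y + dotv (grad f y) (x - y) - mu / 2 * enorm (x - y) ^+ 2.

Record acpp_assumptions (R : realType) m (d : 'I_m.+1 -> nat)
    (f : bvec R d -> R) (L : 'I_m.+1 -> R) (Lg mu : R) (xs : bvec R d) :
    Prop := {
  acpp_differentiable : forall x, differentiable f x ;
  acpp_continuous_grad : continuous (grad f) ;
  acpp_block_const_gt0 : forall i, 0 < L i ;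
  acpp_block_smooth : forall i (x : bvec R d) (u : 'cV[R]_(d i)),
    enorm (bgrad f i x - bgrad f i (x + blockU d i *m u)) <= L i * enorm u ;
  acpp_const_gt0 : 0 < Lg ;
  acpp_smooth : forall x y,
    enorm (grad f x - grad f y) <= Lg * enorm (x - y) ;
  acpp_mu_gt0 : 0 < mu ;
  acpp_weakly_convex : weakly_convex mu f ;
  acpp_level_sets : forall r : R, bounded_set [set x | f x <= r] ;
  acpp_minimizer : is_argmin f xs }.

Definition shiftL (R : realType) m (L : 'I_m.+1 -> R) (mu : R) (i : 'I_m.+1) :
    R := L i + 2 * mu.

Definition bmax (R : realType) m (a : 'I_m.+1 -> R) : R :=
  \big[Num.max/a ord0]_i a i.

Definition bmin (R : realType) m (a : 'I_m.+1 -> R) : R :=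
  \big[Num.min/a ord0]_i a i.

Definition kappa (R : realType) m (Lt : 'I_m.+1 -> R) (s : R) : R :=
  bmax (fun i => Lt i `^ s) / bmin (fun i => Lt i `^ s).

Definition acd_T (R : realType) m (Lt : 'I_m.+1 -> R) (s : R) : R :=
  \sum_i Lt i `^ ((1 - s) / 2).

Definition acd_p (R : realType) m (Lt : 'I_m.+1 -> R) (s : R) (i : 'I_m.+1) :
    R :=
  Lt i `^ ((1 - s) / 2) / acd_T Lt s.

Definition acd_alpha (R : realType) m (Lt : 'I_m.+1 -> R) (s mus : R) : R :=
  Num.sqrt mus / (Num.sqrt mus + acd_T Lt s).

Definition acd_beta (R : realType) m (Lt : 'I_m.+1 -> R) (s mus : R) : R :=
  Num.sqrt mus * acd_T Lt s.

Inductive acd_option := OptionI | OptionII.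

(* One iteration (w^j, z^j) |-> (w^{j+1}, z^{j+1}) with sampled block i. In
   Option I, adding U_i (v - wbar_i) to wbar replaces its i-th block by v. *)
Definition acd_step (R : realType) m (d : 'I_m.+1 -> nat) (opt : acd_option)
    (q : bvec R d -> R) (Lt : 'I_m.+1 -> R) (s mus : R) (i : 'I_m.+1)
    (wz : bvec R d * bvec R d) : bvec R d * bvec R d :=
  let: (w, z) := wz in
  let alpha := acd_alpha Lt s mus in
  let beta := acd_beta Lt s mus in
  let gamma := mus in
  let p := acd_p Lt s i in
  let y := (1 - alpha) *: w + alpha *: z in
  let z' := argmin (fun x : bvec R d =>
    dotv (bgrad q i y) (blk i x)
    + p * gamma / 2 * wnorm Lt s (x - y) ^+ 2
    + p * beta / 2 * wnorm Lt s (x - z) ^+ 2) in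
  let wbar := y + (alpha / p) *: (blockU d i *m (blk i z' - blk i z)) in
  let w' := match opt with
    | OptionI =>
        let v := argmin (fun x : 'cV[R]_(d i) =>
          dotv (bgrad q i wbar) x
          + Lt i / 2 * enorm (x - blk i wbar) ^+ 2) in
        wbar + blockU d i *m (v - blk i wbar)
    | OptionII => wbar
    end in
  (w', z').

Fixpoint acd_iter (R : realType) m (d : 'I_m.+1 -> nat) (opt : acd_option)
    (q : bvec R d -> R) (Lt : 'I_m.+1 -> R) (s mus : R)
    (smp : nat -> 'I_m.+1) (w0 : bvec R d) (n : nat) : bvec R d * bvec R d :=
  if n is j.+1 then
    acd_step opt q Lt s mus (smp j) (acd_iter opt q Lt s mus smp w0 j)
  else (w0, w0).

Definition acd (R : realType) m (d : 'I_m.+1 -> nat) (opt : acd_option)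
    (q : bvec R d -> R) (Lt : 'I_m.+1 -> R) (s mus : R)
    (smp : nat -> 'I_m.+1) (w0 : bvec R d) (t : nat) : bvec R d :=
  (acd_iter opt q Lt s mus smp w0 t).1.

Definition acpp_mus (R : realType) m (Lt : 'I_m.+1 -> R) (s mu : R) : R :=
  mu / bmax Lt `^ s.

(* The outer iterate x^k; smp k j is the block sampled at inner iteration j of
   outer iteration k. *)
Fixpoint acpp (R : realType) m (d : 'I_m.+1 -> nat) (opt : acd_option)
    (f : bvec R d -> R) (L : 'I_m.+1 -> R) (mu s : R) (t : nat)
    (smp : nat -> nat -> 'I_m.+1) (x0 : bvec R d) (k : nat) : bvec R d :=
  if k is k'.+1 then
    let xk := acpp opt f L mu s t smp x0 k' in
    let Lt := shiftL L mu in
    acd opt (fun x => f x + mu * enorm (x - xk) ^+ 2) Lt s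
      (acpp_mus Lt s mu) (smp k') xk t
  else x0.

(* K + 1 outer iterations of t inner iterations each; an inner iteration uses
   two block gradients in Option I (at y^j and at wbar^{j+1}) and one in
   Option II. *)
Definition acpp_block_updates (opt : acd_option) (t K : nat) : nat :=
  (if opt is OptionI then 2 else 1) * (t * K.+1).

Definition acpp_eta (R : realType) m (L : 'I_m.+1 -> R) (mu s : R) : R :=
  let Lt := shiftL L mu in acd_alpha Lt s (acpp_mus Lt s mu).

Definition acpp_lambdat (R : realType) (Lg mu : R) : R :=
  Num.min 8^-1 (Num.min (mu / (4 * Lg)) (mu ^+ 2 / Lg ^+ 2)).

(* The argument of the ceiling is positive, so absz is only a cast to nat. *)
Definition acpp_tmin (R : realType) m (L : 'I_m.+1 -> R) (Lg mu s : R) : nat :=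
  `|Num.ceil (- (acpp_eta L mu s)^-1 * ln (acpp_lambdat Lg mu))|%N.

Definition rv_events (T V : Type) (X : T -> V) : set (set T) :=
  [set X @^-1` B | B in [set: set V]].

Definition mutually_independent (R : realType) (disp : measure_display)
    (T : measurableType disp) (P : probability T R) (A : finType)
    (G : A -> set (set T)) : Prop :=
  forall (J : {set A}) (E : A -> set T),
    (forall a, a \in J -> G a (E a)) ->
    P (\bigcap_(a in [set` J]) E a) = (\prod_(a in J) P (E a))%E.

(* The randomness of one run: block samples I k j (0 <= k <= K, 0 <= j < t) and
   the output index khat (the index None in the independence clause). All these
   variables are discrete, so they generate the sigma-algebras rv_events. *)
Record acpp_sampling (R : realType) (disp : measure_display)
    (T : measurableType disp) (P : probability T R) m (p : 'I_m.+1 -> R)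
    (K t : nat) (I : nat -> nat -> T -> 'I_m.+1) (khat : T -> nat) : Prop := {
  sampling_block_rv : forall k j, (k <= K)%N -> (j < t)%N ->
    rv_events (I k j) `<=` measurable ;
  sampling_block_law : forall k j i, (k <= K)%N -> (j < t)%N ->
    P [set w | I k j w = i] = (p i)%:E ;
  sampling_output_rv : rv_events khat `<=` measurable ;
  sampling_output_range : forall w, (2 <= khat w <= K.+1)%N ;
  sampling_output_law : forall c, (2 <= c <= K.+1)%N ->
    P [set w | khat w = c] = (K%:R^-1)%:E ;
  sampling_independent : mutually_independent P
    (fun a : option ('I_K.+1 * 'I_t) =>
       match a with
       | Some kj => rv_events (I kj.1 kj.2)
       | None => rv_events khat
       end) }.

Definition acpp_mean_sqr_grad (R : realType) (disp : measure_display)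
    (T : measurableType disp) (P : probability T R) m (d : 'I_m.+1 -> nat)
    (opt : acd_option) (f : bvec R d -> R) (L : 'I_m.+1 -> R) (mu s : R)
    (t : nat) (I : nat -> nat -> T -> 'I_m.+1) (khat : T -> nat)
    (x0 : bvec R d) : \bar R :=
  'E_P[fun w =>
    (enorm (grad f (acpp opt f L mu s t (fun k j => I k j w) x0 (khat w)))
      ^+ 2)%R]%E.

(* Main.v *)
Require Import Defs.
From mathcomp Require Import ring lra zify measurable_realfun.

Set Implicit Arguments.
Unset Strict Implicit.
Unset Printing Implicit Defensive.

Local Open Scope classical_set_scope.
Local Open Scope ring_scope.

(** Write [F_c x = f x + mu |x - c|^2] for the objective of an outer iteration
    with center [c], [prox c] for its minimizer, and
    [gap c = f c - F_c (prox c)] for the decrease that an exact proximal step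
    would achieve. Weak convexity makes [F_c] [mu]-strongly convex, and its
    block smoothness constants are [L i + 2 mu].

    The inner method contracts, in the mean over one sampled block, the
    potential [q w - q x + mus / 2 |x - z|_w^2] by the factor [1 - eta]
    ([acd_step_contraction]). For [q = F_c], [x = prox c] and [w = z = c] the
    potential is at most [2 gap c] ([prox_start_le]), so after [t] iterations
    the mean error [F_c x' - F_c (prox c)] of the new center [x'] is at most
    [2 lambda gap c] ([mean_inner_error]). Two consequences:
    - the mean of [f] decreases by at least [(1 - 2 lambda) gap c] in one outer
      iteration, so the gaps at the iterates [x_1], ..., [x_K] sum in the mean
      to at most [(E f(x_1) - f xs) / (1 - 2 lambda)] ([mean_gap_sum]); comparing
      the first proximal step with [xs] bounds the numerator by
      [mu |x0 - xs|^2 + 2 lambda (f x0 - f xs)] ([mean_f_first]);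
    - the gradient of [f] at [prox c] is [- 2 mu (prox c - c)], and by strong
      convexity [|prox c - c|^2] and [|x' - prox c|^2] are controlled by the gap
      and the error, so the mean of [|grad f x'|^2] is at most
      [(16 mu^2 + 8 lambda Lg^2) / mu] times the mean gap
      ([mean_sqr_grad_next]).
    Averaging over the output index gives the first claim, as [kappas >= 1].

    Every run uses finitely many discrete samples, so the expectation is a
    finite sum over tables of samples weighted by products of the block
    probabilities ([acpp_mean_sqr_gradE]). Conditioning on the past is then
    resampling a single coordinate of the table ([iid_mean_resample]).

    For the second claim, [t >= tmin] makes [lambda] at most the minimum that
    [acpp_lambdat] denotes; its three terms make the right-hand side at most
    [40 mu^2 kappas |x0 - xs|^2 / K] ([acpp_mean_sqr_grad_le_eps]), which
    dictates [K]. *)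

(** * Euclidean geometry and block decomposition *)

Section EuclideanSpace.
Variables (R : realType) (n : nat).
Implicit Types (x y z : 'cV[R]_n) (a : R).

Lemma dotvE x y : dotv x y = (x^T *m y) 0 0.
Proof. by rewrite mxE; apply: eq_bigr => i _; rewrite mxE. Qed.

Lemma dotvC x y : dotv x y = dotv y x.
Proof. by apply: eq_bigr => i _; rewrite mulrC. Qed.

Lemma dotvDl x y z : dotv (x + y) z = dotv x z + dotv y z.
Proof. by rewrite -big_split; apply: eq_bigr => i _; rewrite mxE mulrDl. Qed.

Lemma dotvZl a x y : dotv (a *: x) y = a * dotv x y.
Proof.
by rewrite /dotv big_distrr /=; apply: eq_bigr => i _; rewrite mxE mulrA.
Qed.

Lemma dotvNl x y : dotv (- x) y = - dotv x y.
Proof. by rewrite -scaleN1r dotvZl mulN1r. Qed.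

Lemma dotvDr x y z : dotv z (x + y) = dotv z x + dotv z y.
Proof. by rewrite dotvC dotvDl !(dotvC z). Qed.

Lemma dotvZr a x y : dotv x (a *: y) = a * dotv x y.
Proof. by rewrite dotvC dotvZl dotvC. Qed.

Lemma dotvNr x y : dotv x (- y) = - dotv x y.
Proof. by rewrite dotvC dotvNl dotvC. Qed.

Lemma dotv0r x : dotv x 0 = 0.
Proof. by rewrite -(scale0r 0) dotvZr mul0r. Qed.

Lemma dotv0l x : dotv 0 x = 0.
Proof. by rewrite dotvC dotv0r. Qed.

Lemma dotv_ge0 x : 0 <= dotv x x.
Proof. by apply: sumr_ge0 => i _; exact: sqr_ge0. Qed.

Lemma dotv_eq0 x : (dotv x x == 0) = (x == 0).
Proof.
apply/eqP/eqP => [|->]; last exact: dotv0r.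
move/eqP; rewrite psumr_eq0 => [/allP x0|i _]; last exact: sqr_ge0.
apply/colP => i; have := x0 i (mem_index_enum _).
by rewrite mulf_eq0 orbb mxE => /eqP.
Qed.

Lemma enorm_ge0 x : 0 <= enorm x.
Proof. exact: sqrtr_ge0. Qed.

Lemma sqr_enorm x : enorm x ^+ 2 = dotv x x.
Proof. by rewrite sqr_sqrtr // dotv_ge0. Qed.

Lemma enormZ a x : enorm (a *: x) = `|a| * enorm x.
Proof.
by rewrite /enorm dotvZl dotvZr mulrA -expr2 sqrtrM ?sqr_ge0 // sqrtr_sqr.
Qed.

Lemma enormN x : enorm (- x) = enorm x.
Proof. by rewrite -scaleN1r enormZ normrN1 mul1r. Qed.

Lemma enorm_le_dotv a x y : 0 <= a -> enorm x <= a * enorm y ->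
  dotv x x <= a ^+ 2 * dotv y y.
Proof.
move=> a0 xy; rewrite -!sqr_enorm -exprMn ler_sqr // nnegrE ?enorm_ge0 //.
by rewrite mulr_ge0 // enorm_ge0.
Qed.

Lemma dotv_young a x y : 0 < a ->
  dotv x y <= (2 * a)^-1 * dotv x x + a / 2 * dotv y y.
Proof.
move=> a0; have := dotv_ge0 (x - a *: y).
rewrite !(dotvDl, dotvDr, dotvNl, dotvNr, dotvZl, dotvZr) (dotvC y x) => sq.
rewrite -(ler_pM2l (_ : 0 < 2 * a)); last lra.
have -> : 2 * a * ((2 * a)^-1 * dotv x x + a / 2 * dotv y y) =
          dotv x x + a ^+ 2 * dotv y y by field; rewrite gt_eqF.
by lra.
Qed.

(** The form of Cauchy-Schwarz that smoothness estimates call for; it is Young's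
    inequality with weight [c]. *)
Lemma dotv_le_lip c x y : 0 < c -> enorm x <= c * enorm y ->
  dotv x y <= c * dotv y y.
Proof.
move=> c0 /(enorm_le_dotv (ltW c0)) xy.
apply: (le_trans (dotv_young x y c0)).
have : (2 * c)^-1 * dotv x x <= (2 * c)^-1 * (c ^+ 2 * dotv y y).
  by rewrite ler_wpM2l // invr_ge0; lra.
have -> : (2 * c)^-1 * (c ^+ 2 * dotv y y) = c / 2 * dotv y y.
  by field; rewrite gt_eqF.
by lra.
Qed.

End EuclideanSpace.

Definition dotv_linear := (dotvDl, dotvDr, dotvNl, dotvNr, dotvZl, dotvZr).

Section Blocks.
Variables (R : realType) (m : nat) (d : 'I_m.+1 -> nat).
Implicit Types (x y : bvec R d) (i j : 'I_m.+1).

Lemma blkD i x y : blk i (x + y) = blk i x + blk i y.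
Proof. exact: mulmxDr. Qed.

Lemma blkZ i a x : blk i (a *: x) = a *: blk i x.
Proof. by rewrite /blk -scalemxAr. Qed.

Lemma blkN i x : blk i (- x) = - blk i x.
Proof. exact: mulmxN. Qed.

Lemma blkB i x y : blk i (x - y) = blk i x - blk i y.
Proof. by rewrite blkD blkN. Qed.

Lemma blk_submxcol i x : blk i x = submxcol x i.
Proof. by rewrite /blk tr_submxrow trmx1 submxcol_mul mul1mx. Qed.

Lemma blockU_sum : \sum_i blockU d i *m (blockU d i)^T = 1%:M :> 'M[R]_(_).
Proof.
have U1 := mxrow_blockU R d.
by rewrite -mul_mxrow_mxcol -tr_mxrow U1 trmx1 mulmx1.
Qed.

Lemma dotv_blockU i (u : 'cV[R]_(d i)) y :
  dotv (blockU d i *m u) y = dotv u (blk i y).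
Proof. by rewrite !dotvE trmx_mul mulmxA. Qed.

Lemma dotv_sum_blk x y : dotv x y = \sum_i dotv (blk i x) (blk i y).
Proof.
rewrite dotvE -[y in LHS]mul1mx -blockU_sum mulmx_suml mulmx_sumr summxE.
apply: eq_bigr => i _; rewrite dotvE /blk trmx_mul trmxK.
by rewrite !mulmxA.
Qed.

Lemma blk_blockU_coord i j (u : 'cV[R]_(d i)) k : blk j (blockU d i *m u) k 0 =
  \sum_p (tagnat.Rank j k == tagnat.Rank i p)%:R * u p 0.
Proof. by rewrite blk_submxcol !mxE; apply: eq_bigr => p _; rewrite !mxE. Qed.

Lemma blk_blockU i (u : 'cV[R]_(d i)) : blk i (blockU d i *m u) = u.
Proof.
apply/colP => k; rewrite blk_blockU_coord (bigD1 k) //= eqxx mul1r.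
rewrite big1 ?addr0 // => p pk.
by rewrite /tagnat.Rank (inj_eq tagnat.rank_inj) eq_Tagged /= eq_sym (negPf pk)
  mul0r.
Qed.

Lemma blk_blockU_neq i j (u : 'cV[R]_(d i)) :
  j != i -> blk j (blockU d i *m u) = 0.
Proof.
move=> ji; apply/colP => k; rewrite blk_blockU_coord mxE big1 // => p _.
case: eqP => [/(congr1 (@tagnat.sig1 _ d))|]; last by rewrite mul0r.
by rewrite !tagnat.Rank1K => ji'; rewrite ji' eqxx in ji.
Qed.

End Blocks.

(** * Weighted norms and quadratic models *)

Section WeightedNorm.
Variables (R : realType) (m : nat) (d : 'I_m.+1 -> nat).
Variables (Lt : 'I_m.+1 -> R) (s : R).
Implicit Types (x y z : bvec R d) (i j : 'I_m.+1).

Definition wdot x y : R := \sum_i Lt i `^ s * dotv (blk i x) (blk i y).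

Lemma sqr_wnorm x : wnorm Lt s x ^+ 2 = wdot x x.
Proof.
have ge0 i : 0 <= Lt i `^ s * dotv (blk i x) (blk i x).
  by rewrite mulr_ge0 ?powR_ge0 ?dotv_ge0.
rewrite /wnorm; under eq_bigr do rewrite sqr_enorm.
by rewrite sqr_sqrtr // sumr_ge0.
Qed.

Lemma wdotC x y : wdot x y = wdot y x.
Proof. by apply: eq_bigr => i _; rewrite dotvC. Qed.

Lemma wdotDl x y z : wdot (x + y) z = wdot x z + wdot y z.
Proof.
by rewrite -big_split; apply: eq_bigr => i _; rewrite blkD dotvDl mulrDr.
Qed.

Lemma wdotZl a x y : wdot (a *: x) y = a * wdot x y.
Proof.
rewrite /wdot big_distrr /=; apply: eq_bigr => i _.
by rewrite blkZ dotvZl mulrCA.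
Qed.

Lemma wdotNl x y : wdot (- x) y = - wdot x y.
Proof. by rewrite -scaleN1r wdotZl mulN1r. Qed.

Lemma wdotDr x y z : wdot z (x + y) = wdot z x + wdot z y.
Proof. by rewrite wdotC wdotDl !(wdotC z). Qed.

Lemma wdotZr a x y : wdot x (a *: y) = a * wdot x y.
Proof. by rewrite wdotC wdotZl wdotC. Qed.

Lemma wdotNr x y : wdot x (- y) = - wdot x y.
Proof. by rewrite wdotC wdotNl wdotC. Qed.

Lemma wdot_blockU i (u : 'cV[R]_(d i)) y :
  wdot (blockU d i *m u) y = Lt i `^ s * dotv u (blk i y).
Proof.
rewrite /wdot (bigD1 i) //= blk_blockU big1 ?addr0 // => j ji.
by rewrite blk_blockU_neq // dotv0l mulr0.
Qed.

Lemma wdot_term_ge0 i x : 0 <= Lt i `^ s * dotv (blk i x) (blk i x).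
Proof. by rewrite mulr_ge0 ?powR_ge0 ?dotv_ge0. Qed.

Lemma wdot_ge0 x : 0 <= wdot x x.
Proof. by apply: sumr_ge0 => i _; exact: wdot_term_ge0. Qed.

Lemma wdot_ge_blk i x : Lt i `^ s * dotv (blk i x) (blk i x) <= wdot x x.
Proof.
by rewrite /wdot (bigD1 i) //= lerDl sumr_ge0 // => j _; exact: wdot_term_ge0.
Qed.

Lemma wdot_le_dotv c x : (forall i, Lt i `^ s <= c) -> wdot x x <= c * dotv x x.
Proof.
move=> Lc; rewrite dotv_sum_blk big_distrr /=; apply: ler_sum => i _.
by rewrite ler_wpM2r // dotv_ge0.
Qed.

Lemma wdot_gt0 x : (forall i, 0 < Lt i) -> x != 0 -> 0 < wdot x x.
Proof.
move=> L0 x0; rewrite lt0r wdot_ge0 andbT; apply: contraNneq x0.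
move=> /eqP; rewrite psumr_eq0 => [/allP w0|i _]; last exact: wdot_term_ge0.
rewrite -dotv_eq0 dotv_sum_blk big1 // => i _.
have := w0 i (mem_index_enum _); rewrite mulf_eq0 gt_eqF ?powR_gt0 //=.
by move/eqP.
Qed.

End WeightedNorm.

Definition wdot_linear := (wdotDl, wdotDr, wdotNl, wdotNr, wdotZl, wdotZr).

Lemma argmin_unique (R : realType) (V : pointedType) (g : V -> R) x :
  (forall y, y <> x -> g x < g y) -> argmin g = x.
Proof.
move=> gx; have xmin : is_argmin g x.
  by move=> y; have [->|/gx/ltW] := pselect (y = x).
have /(_ x) := getPex (ex_intro (fun x => is_argmin g x) x xmin).
rewrite -/(argmin g) => le; apply: contrapT => /gx; rewrite ltNge.
by move/negP; apply.
Qed.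

(** The Option I update is a gradient step: completing the square exhibits a
    strict, hence unique, minimizer, which determines the value of [argmin]. *)
Lemma argmin_quadratic (R : realType) n (g c : 'cV[R]_n) (l : R) : 0 < l ->
  argmin (fun x : 'cV[R]_n => dotv g x + l / 2 * enorm (x - c) ^+ 2)
  = c - l^-1 *: g.
Proof.
move=> l0; apply: argmin_unique => x /eqP xc; rewrite !sqr_enorm.
set h := x - (c - l^-1 *: g).
have -> : x = c - l^-1 *: g + h by rewrite addrC subrK.
have h0 : 0 < dotv h h.
  by rewrite lt0r dotv_ge0 dotv_eq0 subr_eq0 xc.
have -> : c - l^-1 *: g - c = - (l^-1 *: g) by rewrite addrAC subrr add0r.
have -> : c - l^-1 *: g + h - c = h - l^-1 *: g.
  by rewrite addrAC (addrAC c) subrr add0r addrC.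
move: h h0 => h h0; rewrite !dotv_linear (dotvC h g) -subr_gt0.
rewrite [X in 0 < X](_ : _ = l / 2 * dotv h h); last by field; rewrite gt_eqF.
by rewrite mulr_gt0 // divr_gt0.
Qed.

(** * One iteration of the accelerated coordinate descent method *)

Section ACDStep.
Variables (R : realType) (m : nat) (d : 'I_m.+1 -> nat).
Variables (Lt : 'I_m.+1 -> R) (s mus : R).
Hypothesis Lt_gt0 : forall i, 0 < Lt i.
Hypothesis mus_gt0 : 0 < mus.
Implicit Types (x y w z : bvec R d) (i : 'I_m.+1).

Let T := acd_T Lt s.
Let p := acd_p Lt s.
Let a := acd_alpha Lt s mus.
Let b := acd_beta Lt s mus.

Lemma acd_T_gt0 : 0 < T.
Proof.
rewrite /T /acd_T (bigD1 ord0) //= ltr_pwDl ?powR_gt0 //.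
by rewrite sumr_ge0 // => i _; rewrite powR_ge0.
Qed.

Lemma acd_p_gt0 i : 0 < p i.
Proof. by rewrite divr_gt0 ?acd_T_gt0 ?powR_gt0. Qed.

Lemma acd_p_sum : \sum_i p i = 1.
Proof. by rewrite -mulr_suml divff // gt_eqF // acd_T_gt0. Qed.

(** What the sampling probabilities are designed for: [Lt i / p i ^+ 2] is the
    same multiple of the weight [Lt i `^ s] for all blocks. *)
Lemma acd_block_ratio i : Lt i = Lt i `^ s * (p i * T) ^+ 2.
Proof.
rewrite /p /acd_p divfK ?gt_eqF ?acd_T_gt0 // expr2.
have L0 r : (r == 0) ==> (Lt i != 0) by apply/implyP => _; rewrite gt_eqF.
rewrite -!powRD ?L0 //.
by have -> : s + ((1 - s) / 2 + (1 - s) / 2) = 1; [field|rewrite powRr1 // ltW].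
Qed.

Lemma acd_alpha_gt0 : 0 < a.
Proof. by rewrite divr_gt0 ?addr_gt0 ?sqrtr_gt0 ?acd_T_gt0. Qed.

Lemma acd_alpha_lt1 : a < 1.
Proof.
by rewrite ltr_pdivrMr ?addr_gt0 ?sqrtr_gt0 ?acd_T_gt0 // mul1r ltrDl acd_T_gt0.
Qed.

Lemma acd_alpha_beta : a * b = (1 - a) * mus.
Proof.
rewrite /a /b /acd_alpha /acd_beta -/T.
rewrite -[X in _ = _ * X](sqr_sqrtr (ltW mus_gt0)).
by field; rewrite gt_eqF // addr_gt0 ?sqrtr_gt0 ?acd_T_gt0.
Qed.

Lemma acd_gamma_beta : a * (mus + b) = mus.
Proof. by rewrite mulrDr acd_alpha_beta; ring. Qed.

Lemma acd_beta_gt0 : 0 < b.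
Proof. by rewrite mulr_gt0 ?sqrtr_gt0 ?acd_T_gt0. Qed.

Lemma acd_step_curvature : (a * T) ^+ 2 <= a * b.
Proof.
rewrite acd_alpha_beta.
have -> : (a * T) ^+ 2 = (1 - a) * mus * (1 - a).
  rewrite /a /acd_alpha -/T -[X in _ * X * _](sqr_sqrtr (ltW mus_gt0)).
  by field; rewrite gt_eqF // addr_gt0 ?sqrtr_gt0 ?acd_T_gt0.
have a1 := acd_alpha_lt1; have a0 := acd_alpha_gt0.
by rewrite ler_piMr ?mulr_ge0 ?(ltW mus_gt0) //; lra.
Qed.

Definition acd_zmodel i (g : 'cV[R]_(d i)) y z x :=
  dotv g (blk i x) + p i * mus / 2 * wnorm Lt s (x - y) ^+ 2
  + p i * b / 2 * wnorm Lt s (x - z) ^+ 2.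

(** The [z]-update minimizes a quadratic with Hessian [p i * (mus + b)] in the
    weighted inner product; around its critical point only that part is left. *)
Lemma acd_zmodel_min i (g : 'cV[R]_(d i)) y z : exists z0, forall x,
  acd_zmodel g y z x = acd_zmodel g y z z0
    + p i * (mus + b) / 2 * wdot Lt s (x - z0) (x - z0).
Proof.
pose c := (p i * (mus + b) * Lt i `^ s)^-1.
have p0 := acd_p_gt0 i; have b0 := acd_beta_gt0.
have Ls0 : 0 < Lt i `^ s by rewrite powR_gt0.
have mb0 : mus + b != 0 by rewrite gt_eqF // addr_gt0.
pose z0 := (mus / (mus + b)) *: y + (b / (mus + b)) *: z
           - c *: (blockU d i *m g).
exists z0 => x; rewrite /acd_zmodel !sqr_wnorm; set h := x - z0.
have -> : x = z0 + h by rewrite addrC subrK.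
move: h => h.
have -> : z0 + h - y = h + (z0 - y) by rewrite addrAC addrC.
have -> : z0 + h - z = h + (z0 - z) by rewrite addrAC addrC.
(* stationarity of the model at [z0] *)
have lin : p i * mus * wdot Lt s h (z0 - y) + p i * b * wdot Lt s h (z0 - z)
           = - dotv g (blk i h).
  rewrite /z0 !wdot_linear (wdotC _ _ h (blockU d i *m g)) wdot_blockU /c.
  by field; rewrite mb0 !gt_eqF.
have e (u : bvec R d) : wdot Lt s (h + u) (h + u) =
    wdot Lt s h h + 2 * wdot Lt s h u + wdot Lt s u u.
  by rewrite !wdot_linear (wdotC _ _ u h); ring.
rewrite !e blkD dotvDr; lra.
Qed.

Lemma acd_zmodel_argmin i (g : 'cV[R]_(d i)) y z x
    (z' := argmin (acd_zmodel g y z)) :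
  acd_zmodel g y z x = acd_zmodel g y z z'
    + p i * (mus + b) / 2 * wdot Lt s (x - z') (x - z').
Proof.
have [z0 z0min] := acd_zmodel_min g y z.
suff -> : z' = z0 by exact: z0min.
apply: argmin_unique => u /eqP uz0; rewrite [ltRHS]z0min ltrDl.
rewrite mulr_gt0 ?wdot_gt0 ?subr_eq0 // divr_gt0 // mulr_gt0 ?acd_p_gt0 //.
by rewrite addr_gt0 // acd_beta_gt0.
Qed.

(** Block descent at [y], plus optimality of the new [z] in its model tested at
    [x]: the last term is the strong convexity of that model. The step length
    [a / p i] makes the second-order term of block descent at most the proximal
    term that the model carries ([acd_step_curvature]). *)
Lemma acd_step_descent (opt : acd_option) (q : bvec R d -> R) i w z x
    (y := (1 - a) *: w + a *: z) (wz' := acd_step opt q Lt s mus i (w, z)) :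
  (forall x (u : 'cV[R]_(d i)), q (x + blockU d i *m u) <=
     q x + dotv (bgrad q i x) u + Lt i / 2 * dotv u u) ->
  q wz'.1 <= q y + a / p i * dotv (bgrad q i y) (blk i (x - z))
    + a * mus / 2 * wdot Lt s (x - y) (x - y)
    + a * b / 2 * wdot Lt s (x - z) (x - z)
    - mus / 2 * wdot Lt s (x - wz'.2) (x - wz'.2).
Proof.
move=> qsm.
have a0 := acd_alpha_gt0; have p0 := acd_p_gt0 i.
have := acd_zmodel_argmin (bgrad q i y) y z x.
rewrite {}/wz' /acd_step; cbv zeta; rewrite -/p -/a -/b -/y.
rewrite -/(acd_zmodel (bgrad q i y) y z).
set z' := argmin _ => model.
set wb := y + _.
have wbar_le : q wb <= q y + a / p i * dotv (bgrad q i y) (blk i (x - z))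
    + a * mus / 2 * wdot Lt s (x - y) (x - y)
    + a * b / 2 * wdot Lt s (x - z) (x - z)
    - mus / 2 * wdot Lt s (x - z') (x - z').
  have -> : wb = y + blockU d i *m ((a / p i) *: blk i (z' - z)).
    by rewrite /wb blkB scalemxAr.
  apply: (le_trans (qsm _ _)); rewrite dotvZr dotvZl dotvZr.
  have quad : Lt i / 2 *
      (a / p i * (a / p i * dotv (blk i (z' - z)) (blk i (z' - z))))
      <= a * b / 2 * wdot Lt s (z' - z) (z' - z).
    apply: (@le_trans _ _ ((a * T) ^+ 2 / 2 *
      (Lt i `^ s * dotv (blk i (z' - z)) (blk i (z' - z))))).
      rewrite [in leLHS]acd_block_ratio le_eqVlt; apply/orP; left; apply/eqP.
      by field; rewrite gt_eqF.
    apply: (@le_trans _ _ (a * b / 2 *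
      (Lt i `^ s * dotv (blk i (z' - z)) (blk i (z' - z))))).
      apply: ler_wpM2r; first exact: wdot_term_ge0.
      by rewrite ler_pM2r ?acd_step_curvature.
    rewrite ler_wpM2l ?wdot_ge_blk // divr_ge0 // mulr_ge0 ?(ltW a0) //.
    exact/ltW/acd_beta_gt0.
  have zy0 : 0 <= a * mus / 2 * wdot Lt s (z' - y) (z' - y).
    by rewrite mulr_ge0 ?wdot_ge0 // divr_ge0 // mulr_ge0 // ltW.
  have /(congr1 (fun r => a / p i * r)) := model.
  rewrite /acd_zmodel !sqr_wnorm.
  rewrite [X in _ = X -> _](_ : _ = a / p i * dotv (bgrad q i y) (blk i z')
    + a * mus / 2 * wdot Lt s (z' - y) (z' - y)
    + a * b / 2 * wdot Lt s (z' - z) (z' - z)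
    + a * (mus + b) / 2 * wdot Lt s (x - z') (x - z')); last first.
    by field; rewrite gt_eqF.
  rewrite [X in X = _ -> _](_ : _ = a / p i * dotv (bgrad q i y) (blk i x)
    + a * mus / 2 * wdot Lt s (x - y) (x - y)
    + a * b / 2 * wdot Lt s (x - z) (x - z)); last first.
    by field; rewrite gt_eqF.
  rewrite acd_gamma_beta => {}model.
  move: quad model; set D := dotv (blk i _) (blk i _).
  by rewrite !blkB !dotvDr !dotvNr; lra.
case: opt => //=.
rewrite argmin_quadratic // (addrAC (blk i wb)) subrr add0r.
apply: le_trans wbar_le; apply: (le_trans (qsm _ _)).
rewrite dotvNr dotvNl dotvNr dotvZl dotvZr.
set G := dotv _ _; have G0 : 0 <= G by exact: dotv_ge0.
have -> : q wb - (Lt i)^-1 * G + Lt i / 2 * - - ((Lt i)^-1 * ((Lt i)^-1 * G))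
  = q wb - (2 * Lt i)^-1 * G by field; rewrite gt_eqF.
by rewrite gerBl mulr_ge0 // invr_ge0 mulr_ge0 // ltW.
Qed.

(** Averaging over the block turns the rescaled block terms into the inner
    product of the full gradient at [y] with [x - z]. As [y] is a convex
    combination of [w] and [z], that splits into a part along [w - y], where
    convexity is used, and a part along [x - y], where strong convexity is. *)
Lemma acd_step_contraction (opt : acd_option) (q : bvec R d -> R) w z x :
  (forall i x (u : 'cV[R]_(d i)), q (x + blockU d i *m u) <=
     q x + dotv (bgrad q i x) u + Lt i / 2 * dotv u u) ->
  (forall x y, q y + dotv (grad q y) (x - y)
     + mus / 2 * wdot Lt s (x - y) (x - y) <= q x) ->
  \sum_i p i * (let wz := acd_step opt q Lt s mus i (w, z) in
     q wz.1 - q x + mus / 2 * wdot Lt s (x - wz.2) (x - wz.2))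
  <= (1 - a) * (q w - q x + mus / 2 * wdot Lt s (x - z) (x - z)).
Proof.
move=> qsm qsc; set y := (1 - a) *: w + a *: z.
have a0 := acd_alpha_gt0; have a1 := acd_alpha_lt1.
pose c := q y - q x + a * mus / 2 * wdot Lt s (x - y) (x - y)
    + a * b / 2 * wdot Lt s (x - z) (x - z).
apply: (@le_trans _ _
  (\sum_i (p i * c + a * dotv (bgrad q i y) (blk i (x - z))))).
  apply: ler_sum => i _ /=.
  have := acd_step_descent opt w z x (qsm i); rewrite -/y.
  set wz := acd_step _ _ _ _ _ _ _ => le.
  have p0 := acd_p_gt0 i.
  set G := dotv _ _ in le *.
  have -> : p i * c + a * G = p i * (c + a / p i * G) by field; rewrite gt_eqF.
  by rewrite ler_pM2l // /c; lra.
rewrite big_split /= -mulr_suml acd_p_sum mul1r -mulr_sumr -dotv_sum_blk.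
have yz : a *: (y - z) = (1 - a) *: (w - y).
  rewrite /y; apply/colP => k; rewrite !mxE; ring.
have : a * dotv (grad q y) (x - z) =
  a * dotv (grad q y) (x - y) + (1 - a) * dotv (grad q y) (w - y).
  by rewrite -[in RHS](dotvZr (1 - a)) -yz dotvZr -mulrDr -dotvDr addrA subrK.
move=> ->.
have h1 : a * (q y + dotv (grad q y) (x - y)
    + mus / 2 * wdot Lt s (x - y) (x - y)) <= a * q x.
  by rewrite ler_pM2l.
have h2 : (1 - a) * (q y + dotv (grad q y) (w - y)) <= (1 - a) * q w.
  rewrite ler_pM2l ?subr_gt0 //; apply: le_trans (qsc w y).
  by rewrite lerDl mulr_ge0 ?wdot_ge0 // divr_ge0 // ltW.
rewrite /c acd_alpha_beta; move: h1 h2; lra.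
Qed.

End ACDStep.

(** * Gradients, descent along a line, existence of proximal points *)

Section Gradient.
Variables (R : realType) (n : nat).
Implicit Types (f : 'cV[R]_n -> R) (x y v c : 'cV[R]_n).

Lemma diff_grad f x v : differentiable f x -> 'd f x v = dotv (grad f x) v.
Proof.
move=> df; rewrite [in LHS](matrix_sum_delta v) linear_sum.
apply: eq_bigr => i _; rewrite big_ord1 linearZ /= mxE -deriveE //.
by rewrite mulrC.
Qed.

Lemma is_derive_line f x v (t : R) : differentiable f (t *: v + x) ->
  is_derive t 1 (fun h : R => f (h *: v + x)) (dotv (grad f (t *: v + x)) v).
Proof.
move=> df.
have dl : is_diff t (fun h : R => h *: v + x) (fun h : R => h *: v).
  apply: is_diff_eq. by rewrite addr0.
have dl' : differentiable (fun h : R => h *: v + x) t by exact: ex_diff.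
split; first by apply: diff_derivable; exact: differentiable_comp.
rewrite deriveE; last exact: differentiable_comp.
by rewrite diff_comp //= diff_val scale1r diff_grad.
Qed.

(** Mean value theorem for [f] minus its quadratic model along [v]. The single
    parameter [M], a Lipschitz constant times the squared length of [v], serves
    both the block constants and the global one. *)
Lemma descent_along f x v (M : R) : (forall x, differentiable f x) ->
  (forall t, 0 < t -> dotv (grad f (x + t *: v) - grad f x) v <= t * M) ->
  f (x + v) <= f x + dotv (grad f x) v + M / 2.
Proof.
move=> df fM.
pose c := dotv (grad f x) v.
pose g : R -> R :=
  (fun h : R => f (h *: v + x)) - (fun h : R => c * h + M / 2 * h ^+ 2).
pose dg (t : R) : R := dotv (grad f (t *: v + x)) v - (c + M * t).
have dgE (t : R) : is_derive t 1 g (dg t).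
  apply: is_deriveB; first exact: is_derive_line.
  apply: is_derive_eq.
  by change (c * 1 + M / 2 * (t * 1 + t * 1) = c + M * t); field.
have [t] : exists2 t, t \in `]0, 1[%R & g 1 - g 0 = dg t * (1 - 0).
  apply: MVT => //.
  apply: continuous_subspaceT => r; apply: differentiable_continuous.
  by apply/derivable1_diffP; exact: (@ex_derive _ _ _ _ _ _ _ (dgE r)).
rewrite in_itv /= => /andP[t0 _]; rewrite subr0 mulr1.
rewrite /g /dg !fctE.
have := fM t t0; rewrite dotvDl dotvNl.
rewrite scale1r scale0r add0r addrC (addrC (t *: v)) /c (addrC v x). lra.
Qed.

Definition proxf (mu : R) f c x : R := f x + mu * enorm (x - c) ^+ 2.

Lemma is_derive_sqr_enorm x v c :
  is_derive x v (fun x => enorm (x - c) ^+ 2) (2 * dotv (x - c) v).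
Proof.
pose g (h : R) : R :=
  dotv (x - c) (x - c) + (2 * dotv (x - c) v) * h + dotv v v * h ^+ 2.
have gE : g = fun h => enorm (h *: v + x - c) ^+ 2.
  apply/funext => h; rewrite sqr_enorm -addrA !dotv_linear.
  rewrite (dotvC v x) (dotvC v c).
  rewrite /g !dotv_linear; ring.
have dg : is_derive (0 : R) (1 : R) g (2 * dotv (x - c) v).
  rewrite /g; apply: is_derive_eq.
  by change ((0 + 1) * (2 * dotv (x - c) v * 1) + dotv v v * (0 * 1 + 0 * 1) =
    2 * dotv (x - c) v); ring.
have quotE : (fun h : R => h^-1 *: ((g \o shift 0) (h *: 1) - g 0)) =
  (fun h => h^-1 *: (((fun x => enorm (x - c) ^+ 2) \o shift x) (h *: v)
     - enorm (x - c) ^+ 2)).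
  apply/funext => h; rewrite gE /= addr0 scale0r add0r.
  by rewrite [h *: 1]mulr1.
have [dg1 dg2] := dg.
by split; [rewrite /derivable -quotE|rewrite /derive -quotE].
Qed.

Lemma grad_proxf mu f c x : differentiable f x ->
  grad (proxf mu f c) x = grad f x + (2 * mu) *: (x - c).
Proof.
move=> df; apply/colP => j; rewrite !mxE.
have dq := is_derive_sqr_enorm x (delta_mx j 0) c.
have := derivableP (diff_derivable (v := delta_mx j 0) df) => dfj.
have -> : proxf mu f c = f + (mu *: (fun x => enorm (x - c) ^+ 2)).
  by apply/funext => y; rewrite /proxf fctE.
rewrite derive_val; congr (_ + _).
change (mu * (2 * dotv (x - c) (delta_mx j 0)) = 2 * mu * (x j 0 - c j 0)).
rewrite mulrA (mulrC mu); congr (_ * _).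
rewrite /dotv (bigD1 j) //= big1 ?addr0.
  by rewrite !mxE !eqxx mulr1.
by move=> i ij; rewrite !mxE (negPf ij) mulr0.
Qed.

Lemma proxf_continuous mu f c : (forall x, differentiable f x) ->
  continuous (proxf mu f c).
Proof.
move=> df x; have fc := differentiable_continuous (df x).
rewrite /proxf. apply: (cvgD fc).
apply: cvgM; first exact: cvg_cst.
have -> : (fun y => enorm (y - c) ^+ 2) =
    fun y => \sum_i (y i 0 - c i 0) * (y i 0 - c i 0).
  by apply/funext => y; rewrite sqr_enorm; apply: eq_bigr => i _; rewrite !mxE.
have -> : enorm (x - c) ^+ 2 = \sum_i (x i 0 - c i 0) * (x i 0 - c i 0).
  by rewrite sqr_enorm; apply: eq_bigr => i _; rewrite !mxE.
apply: cvg_big => [|i _]; first exact: add_continuous.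
have ci : ((y : 'cV[R]_n) i 0 - c i 0) @[y --> x] --> (x i 0 - c i 0 : R).
  have cc := @coord_continuous R n 1 i 0 x.
  exact: (cvgB cc (cvg_cst _)).
exact: (cvgM ci ci).
Qed.

Lemma mx_norm_tr (p q : nat) (A : 'M[R]_(p, q)) : `|A^T| <= `|A|.
Proof.
rewrite [leLHS]/Num.Def.normr /= mx_normrE.
apply/bigmax_leP; split => // -[i j] _ /=.
rewrite mxE [leRHS]/Num.Def.normr /= mx_normrE.
by apply: (le_bigmax _ (fun k => `|A k.1 k.2|) (j, i)).
Qed.

Lemma trmx_continuous (p q : nat) : continuous (@trmx R p q).
Proof.
move=> A; apply/(@cvgrPdist_lt _ _ _ (nbhs A)) => e e0; near=> B.
rewrite -linearB; apply: le_lt_trans (mx_norm_tr _) _.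
by near: B; exact: cvgr_dist_lt.
Unshelve. all: by end_near. Qed.

Lemma bounded_closed_compact_cV (A : set 'cV[R]_n) :
  bounded_set A -> closed A -> compact A.
Proof.
move=> [M [Mr bA]] cA; have -> : A = trmx @` (trmx @^-1` A).
  apply/seteqP; split => [x Ax|_ [y Ay <-]] //.
  by exists x^T; rewrite /= ?trmxK.
apply: continuous_compact; first exact/continuous_subspaceT/trmx_continuous.
apply: bounded_closed_compact.
  exists M; split => // r Mr' y /(bA r Mr'); apply: le_trans.
  by rewrite -[in leLHS](trmxK y) mx_norm_tr.
by apply: closed_comp cA => y _; exact: trmx_continuous.
Qed.

(** A sublevel set of the proximal objective is contained in one of [f], which
    is bounded, so it is compact. *)
Lemma proxf_has_min mu f c : 0 <= mu -> (forall x, differentiable f x) ->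
  (forall r : R, bounded_set [set x | f x <= r]) ->
  exists x, is_argmin (proxf mu f c) x.
Proof.
move=> mu0 df bf.
pose A := [set x | proxf mu f c x <= proxf mu f c c].
have cA : compact A.
  apply: bounded_closed_compact_cV.
    have [M [Mr bM]] := bf (proxf mu f c c).
    exists M; split => // r Mr' y Ay; apply: bM => //=.
    by apply: le_trans Ay; rewrite lerDl mulr_ge0 // sqr_ge0.
  apply: (@closed_comp _ _ (proxf mu f c) [set r | r <= proxf mu f c c]).
    by move=> y _; exact: proxf_continuous.
  exact: closed_le.
have [||x xA xmin] := compact_EVT_min _ cA _ (f := proxf mu f c).
- by exists c; rewrite /A /=.
- by apply: continuous_subspaceT; exact: proxf_continuous.
exists x => y; have [yA|yA] := leP (proxf mu f c y) (proxf mu f c c).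
  by apply: xmin; rewrite inE.
by rewrite (le_trans _ (ltW yA)) // xmin // inE /A /=.
Qed.
End Gradient.

(** * Proximal subproblems of a weakly convex function *)

Lemma argminP (R : realType) (V : pointedType) (g : V -> R) :
  (exists x, is_argmin g x) -> is_argmin g (argmin g).
Proof. exact: (@getPex _ [set x | is_argmin g x]). Qed.

Section BlockExtrema.
Variables (R : realType) (m : nat).
Implicit Types (a : 'I_m.+1 -> R) (i : 'I_m.+1).

Lemma le_bmax a i : a i <= bmax a.
Proof. exact: le_bigmax. Qed.

Lemma bmin_le a i : bmin a <= a i.
Proof. exact: bigmin_le. Qed.

Lemma bmin_gt0 a : (forall i, 0 < a i) -> 0 < bmin a.
Proof.
move=> a0; rewrite /bmin; elim/big_ind : _ => // x y.
by rewrite lt_min => -> ->.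
Qed.

Lemma kappa_ge1 a s : (forall i, 0 < a i) -> 1 <= kappa a s.
Proof.
move=> a0; have as0 i : 0 < a i `^ s by rewrite powR_gt0.
rewrite /kappa ler_pdivlMr ?bmin_gt0 // mul1r.
exact: le_trans (bmin_le _ ord0) (le_bmax (fun i => a i `^ s) ord0).
Qed.

End BlockExtrema.

Section Smoothness.
Variables (R : realType) (m : nat) (d : 'I_m.+1 -> nat) (f : bvec R d -> R).
Variables (L : 'I_m.+1 -> R) (Lg mu : R) (xs : bvec R d).
Hypothesis H : acpp_assumptions f L Lg mu xs.
Implicit Types (x y c : bvec R d) (i : 'I_m.+1).

Let Lt := shiftL L mu.
Let mu_gt0 := acpp_mu_gt0 H.
Let df := acpp_differentiable H.
Notation F c := (proxf mu f c).

Lemma shiftL_gt0 i : 0 < Lt i.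
Proof. by rewrite addr_gt0 ?(acpp_block_const_gt0 H) // mulr_gt0. Qed.

Lemma block_descent i x (u : 'cV[R]_(d i)) :
  f (x + blockU d i *m u) <= f x + dotv (bgrad f i x) u + L i / 2 * dotv u u.
Proof.
have L0 := acpp_block_const_gt0 H i.
have -> : dotv (bgrad f i x) u = dotv (grad f x) (blockU d i *m u).
  by rewrite (dotvC (grad f x)) dotv_blockU dotvC.
rewrite [X in _ <= _ + X](_ : _ = (L i * dotv u u) / 2); last by ring.
apply: descent_along => // t t0.
rewrite dotvC dotv_blockU blkB dotvC mulrA; apply: dotv_le_lip.
  by rewrite mulr_gt0.
have := acpp_block_smooth H x (t *: u); rewrite enormZ gtr0_norm // -scalemxAr.
by rewrite -enormN opprB mulrCA mulrA.
Qed.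

Lemma global_descent x y :
  f y <= f x + dotv (grad f x) (y - x) + Lg / 2 * dotv (y - x) (y - x).
Proof.
have L0 := acpp_const_gt0 H.
rewrite [X in _ <= _ + X](_ : _ = (Lg * dotv (y - x) (y - x)) / 2); last first.
  by ring.
rewrite -{1}(subrK x y) (addrC _ x); apply: descent_along => // t t0.
rewrite mulrA; apply: dotv_le_lip; first by rewrite mulr_gt0.
apply: (le_trans (acpp_smooth H _ _)).
by rewrite addrAC subrr add0r enormZ gtr0_norm // mulrCA mulrA.
Qed.

Lemma proxf_block_descent c i x (u : 'cV[R]_(d i)) :
  F c (x + blockU d i *m u) <=
  F c x + dotv (bgrad (F c) i x) u + Lt i / 2 * dotv u u.
Proof.
rewrite /bgrad grad_proxf // blkD blkZ /proxf !sqr_enorm.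
have := block_descent x u; rewrite /bgrad.
have -> : x + blockU d i *m u - c = blockU d i *m u + (x - c).
  by rewrite addrAC addrC.
rewrite (dotvDl (blockU d i *m u)) !(dotvDr (blockU d i *m u)).
rewrite (dotvC (x - c) (blockU d i *m u)) !dotv_blockU blk_blockU.
rewrite (dotvDl _ _ u) dotvZl (dotvC (blk i (x - c)) u) /Lt /shiftL.
by lra.
Qed.

Lemma proxf_strongly_convex c x y :
  F c y + dotv (grad (F c) y) (x - y) + mu / 2 * dotv (x - y) (x - y) <= F c x.
Proof.
have := acpp_weakly_convex H x y.
rewrite grad_proxf // /proxf !sqr_enorm.
have -> : x - c = (x - y) + (y - c) by rewrite addrA subrK.
move: (x - y) (y - c) => h k; rewrite !dotv_linear (dotvC h k); lra.
Qed.

(** Otherwise a gradient step in one block would decrease [q]. *)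
Lemma argmin_grad0 (q : bvec R d -> R) (l : 'I_m.+1 -> R) x :
  (forall i, 0 < l i) ->
  (forall i x (u : 'cV[R]_(d i)), q (x + blockU d i *m u) <=
     q x + dotv (bgrad q i x) u + l i / 2 * dotv u u) ->
  is_argmin q x -> grad q x = 0.
Proof.
move=> l0 qsm qx; apply/eqP; rewrite -dotv_eq0 dotv_sum_blk big1 // => i _.
rewrite -/(bgrad q i x); set g := bgrad q i x.
have := le_trans (qx _) (qsm i x (- (l i)^-1 *: g)); rewrite -/g !dotv_linear.
rewrite [X in _ <= X](_ : _ = q x - (2 * l i)^-1 * dotv g g); last first.
  by field; rewrite gt_eqF.
have : 0 <= (2 * l i)^-1 * dotv g g.
  by rewrite mulr_ge0 ?dotv_ge0 // invr_ge0 mulr_ge0 // ltW.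
move=> h1 h2; apply/eqP.
have /eqP : (2 * l i)^-1 * dotv g g = 0 by lra.
by rewrite mulf_eq0 invr_eq0 mulf_eq0 pnatr_eq0 /= gt_eqF.
Qed.

Definition prox c : bvec R d := argmin (F c).

Lemma proxP c : is_argmin (F c) (prox c).
Proof.
apply: argminP; apply: proxf_has_min => //; first exact: ltW.
exact: acpp_level_sets H.
Qed.

Lemma grad_prox c : grad (F c) (prox c) = 0.
Proof.
exact: argmin_grad0 shiftL_gt0 (@proxf_block_descent c) (@proxP c).
Qed.

Lemma proxf_growth c x :
  mu / 2 * dotv (x - prox c) (x - prox c) <= F c x - F c (prox c).
Proof.
have := proxf_strongly_convex c x (prox c).
by rewrite grad_prox dotv0l addr0 lerBrDl.
Qed.

Lemma proxf_center c : F c c = f c.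
Proof. by rewrite /proxf subrr sqr_enorm dotv0r mulr0 addr0. Qed.

(** The decrease achieved by one exact proximal step; it controls both the
    progress of the outer loop and the size of the gradient. *)
Definition prox_gap c : R := f c - F c (prox c).

Lemma prox_gap_ge c : mu / 2 * dotv (c - prox c) (c - prox c) <= prox_gap c.
Proof. by have := proxf_growth c c; rewrite proxf_center. Qed.

(** The gradient at [prox c] is exactly [- 2 mu (prox c - c)]; the gradient at a
    nearby point differs from that by the Lipschitz bound. *)
Lemma sqr_grad_le c x : dotv (grad f x) (grad f x) <=
  (16 * mu ^+ 2 * prox_gap c + 4 * Lg ^+ 2 * (F c x - F c (prox c))) / mu.
Proof.
set xh := prox c.
have gxh : grad f xh = - (2 * mu) *: (xh - c).
  have := grad_prox c; rewrite grad_proxf // => /eqP.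
  rewrite addr_eq0 => /eqP ->.
  by rewrite scaleNr.
have lip := enorm_le_dotv (ltW (acpp_const_gt0 H)) (acpp_smooth H x xh).
have par (u v : bvec R d) : dotv u u <= 2 * dotv (u - v) (u - v) + 2 * dotv v v.
  have := dotv_ge0 (u - v - v); rewrite !dotv_linear (dotvC v u); lra.
have := par (grad f x) (grad f xh); rewrite {3 4}gxh !dotvZl !dotvZr.
have := prox_gap_ge c; have := proxf_growth c x; rewrite -/xh.
have -> : dotv (c - xh) (c - xh) = dotv (xh - c) (xh - c).
  by rewrite -(opprB xh c) dotvNl dotvNr opprK.
set e := F c x - _; set N := dotv (xh - c) _; set M := dotv (x - xh) _ in lip *.
move=> he hN hg.
rewrite ler_pdivlMr //.
have hN' : 8 * mu ^+ 2 * (mu * N) <= 8 * mu ^+ 2 * (2 * prox_gap c).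
  rewrite ler_wpM2l ?(mulr_ge0 _ (sqr_ge0 _)) //; lra.
have he' : 2 * Lg ^+ 2 * (mu * M) <= 2 * Lg ^+ 2 * (2 * e).
  rewrite ler_wpM2l ?(mulr_ge0 _ (sqr_ge0 _)) //; lra.
apply: (@le_trans _ _ ((2 * (Lg ^+ 2 * M) + 2 * (2 * mu * (2 * mu * N))) * mu)).
  by rewrite ler_pM2r //; lra.
lra.
Qed.

Variable s : R.
Hypothesis s_ge0 : 0 <= s.

Lemma powR_shiftL_le i : Lt i `^ s <= bmax Lt `^ s.
Proof.
have Lti := ltW (shiftL_gt0 i).
by apply: ge0_ler_powR; rewrite ?nnegrE ?le_bmax // (le_trans Lti) ?le_bmax.
Qed.

Lemma bmax_powR_gt0 : 0 < bmax Lt `^ s.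
Proof. by rewrite powR_gt0 // (lt_le_trans (shiftL_gt0 ord0)) ?le_bmax. Qed.

Lemma acpp_mus_gt0 : 0 < acpp_mus Lt s mu.
Proof. by rewrite divr_gt0 ?bmax_powR_gt0. Qed.

Lemma acpp_mus_wdot x : acpp_mus Lt s mu * wdot Lt s x x <= mu * dotv x x.
Proof.
rewrite /acpp_mus -mulrA ler_pM2l // ler_pdivrMl ?bmax_powR_gt0 //.
exact/wdot_le_dotv/powR_shiftL_le.
Qed.

Lemma proxf_wconvex c x y (mus := acpp_mus Lt s mu) :
  F c y + dotv (grad (F c) y) (x - y) + mus / 2 * wdot Lt s (x - y) (x - y)
  <= F c x.
Proof.
apply: le_trans (proxf_strongly_convex c x y); rewrite lerD2l.
by have := acpp_mus_wdot (x - y); rewrite -/mus; lra.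
Qed.

Lemma prox_start_le c (mus := acpp_mus Lt s mu) :
  F c c - F c (prox c) + mus / 2 * wdot Lt s (prox c - c) (prox c - c)
  <= 2 * prox_gap c.
Proof.
have := acpp_mus_wdot (prox c - c); rewrite -/mus.
have := prox_gap_ge c; rewrite -(opprB (prox c)) dotvNl dotvNr opprK.
by rewrite proxf_center /prox_gap; lra.
Qed.

End Smoothness.

(** * Means over independent samples, and the outer loop *)

Section IidMean.
Variables (R : realType) (A B : finType) (p : B -> R).
Hypotheses (p_ge0 : forall i, 0 <= p i) (p_sum : \sum_i p i = 1).
Implicit Types (om : {ffun A -> B}) (phi psi : {ffun A -> B} -> R).

Definition iid_weight om : R := \prod_a p (om a).

Definition iid_mean phi : R := \sum_om iid_weight om * phi om.

Definition ffupd om a i : {ffun A -> B} :=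
  [ffun b => if b == a then i else om b].

Lemma iid_weight_ge0 om : 0 <= iid_weight om.
Proof. exact: prodr_ge0. Qed.

Lemma iid_weight_sum : \sum_om iid_weight om = 1.
Proof.
rewrite -(bigA_distr_bigA (fun _ => p)) /= big1 // => a _; exact: p_sum.
Qed.

Lemma iid_mean_cst c : iid_mean (fun=> c) = c.
Proof. by rewrite /iid_mean -mulr_suml iid_weight_sum mul1r. Qed.

Lemma iid_meanD phi psi :
  iid_mean (fun om => phi om + psi om) = iid_mean phi + iid_mean psi.
Proof. by rewrite -big_split; apply: eq_bigr => om _; rewrite mulrDr. Qed.

Lemma iid_meanZ c phi : iid_mean (fun om => c * phi om) = c * iid_mean phi.
Proof.
by rewrite /iid_mean big_distrr; apply: eq_bigr => om _; rewrite mulrCA.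
Qed.

Lemma le_iid_mean phi psi :
  (forall om, phi om <= psi om) -> iid_mean phi <= iid_mean psi.
Proof.
by move=> le; apply: ler_sum => om _; rewrite ler_wpM2l ?iid_weight_ge0.
Qed.

Lemma iid_weight_upd om a i :
  iid_weight (ffupd om a i) * p (om a) = iid_weight om * p i.
Proof.
rewrite /iid_weight (bigD1 a) //= [in RHS](bigD1 a) //= ffunE eqxx.
rewrite (eq_bigr (fun b => p (om b))) => [|b ba]; last first.
  by rewrite ffunE (negPf ba).
ring.
Qed.

(** Drawing one coordinate afresh does not change the mean: exchanging the old
    and the new value of that coordinate is a weight-preserving involution. *)
Lemma iid_mean_resample a phi :
  iid_mean phi = iid_mean (fun om => \sum_i p i * phi (ffupd om a i)).
Proof.
transitivity (\sum_om \sum_i iid_weight om * p i * phi om).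
  by apply: eq_bigr => om _; rewrite -mulr_suml -mulr_sumr p_sum mulr1.
rewrite /iid_mean; under [RHS]eq_bigr do rewrite big_distrr /=.
rewrite !pair_big /=.
pose sw (u : {ffun A -> B} * B) := (ffupd u.1 a u.2, u.1 a).
have swK : involutive sw.
  move=> [om i]; rewrite /sw /= ffunE eqxx; congr (_, _); apply/ffunP => b.
  by rewrite !ffunE; case: eqP => // ->.
rewrite (reindex_inj (inv_inj swK)) /=; apply: eq_bigr => -[om i] _ /=.
by rewrite iid_weight_upd mulrA.
Qed.

End IidMean.

(** The algorithm reads a stream of samples; the default [ord0] lies outside the
    range that a run of [K + 1] outer and [t] inner iterations reads. *)
Definition table (K t m : nat) (om : {ffun 'I_K.+1 * 'I_t -> 'I_m.+1})
    (k j : nat) : 'I_m.+1 :=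
  if (insub k : option 'I_K.+1, insub j : option 'I_t) is (Some k', Some j')
  then om (k', j') else ord0.

Lemma table_in K t m (om : {ffun 'I_K.+1 * 'I_t -> 'I_m.+1})
  (k : 'I_K.+1) (j : 'I_t) : table om k j = om (k, j).
Proof. by rewrite /table !valK. Qed.

Lemma table_upd K t m (om : {ffun 'I_K.+1 * 'I_t -> 'I_m.+1})
    (k : 'I_K.+1) (j : 'I_t) i (k' j' : nat) :
  table (ffupd om (k, j) i) k' j' =
  if (k' == k) && (j' == j) then i else table om k' j'.
Proof.
rewrite /table; case: insubP => [k1 _ /= <-|hk] /=; last first.
  by case: eqP => [kk|//]; rewrite kk ltn_ord in hk.
case: insubP => [j1 _ /= <-|hj] /=; first by rewrite ffunE xpair_eqE.
by rewrite andbC; case: eqP => [jj|//]; rewrite jj ltn_ord in hj.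
Qed.

Section Locality.
Variables (R : realType) (m : nat) (d : 'I_m.+1 -> nat) (opt : acd_option).

Lemma acd_iter_local q (Lt : 'I_m.+1 -> R) s mus smp smp' (w0 : bvec R d) n :
  (forall j, (j < n)%N -> smp j = smp' j) ->
  acd_iter opt q Lt s mus smp w0 n = acd_iter opt q Lt s mus smp' w0 n.
Proof.
elim: n => //= n IH sE; rewrite sE // IH // => j jn; apply: sE.
by rewrite ltnS ltnW.
Qed.

Lemma acpp_local (f : bvec R d -> R) L mu s t smp smp' x0 k :
  (forall k' j, (k' < k)%N -> (j < t)%N -> smp k' j = smp' k' j) ->
  acpp opt f L mu s t smp x0 k = acpp opt f L mu s t smp' x0 k.
Proof.
elim: k => //= k IH sE; rewrite IH => [|k' j k'k jt].
  rewrite /acd (acd_iter_local _ _ _ _ (smp' := smp' k)) // => j jt.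
  exact: sE.
by apply: sE => //; rewrite ltnS ltnW.
Qed.

End Locality.

Section OuterLoop.
Variables (R : realType) (m : nat) (d : 'I_m.+1 -> nat) (f : bvec R d -> R).
Variables (L : 'I_m.+1 -> R) (Lg mu : R) (xs : bvec R d).
Hypothesis H : acpp_assumptions f L Lg mu xs.
Variables (opt : acd_option) (s : R) (x0 : bvec R d) (K t : nat).
Hypothesis s_ge0 : 0 <= s.

Let Lt := shiftL L mu.
Let mus := acpp_mus Lt s mu.
Let a := acpp_eta L mu s.
Let lambda := (1 - a) ^+ t.
Let A := ('I_K.+1 * 'I_t)%type.
Let B := 'I_m.+1.
Implicit Types (om : {ffun A -> B}).

Local Notation mean := (iid_mean (acd_p Lt s)).
Local Notation F c := (proxf mu f c).
Local Notation prox := (prox f mu).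
Local Notation gap := (prox_gap f mu).

Let Lt_gt0 := shiftL_gt0 H.
Let mus_gt0 : 0 < mus := acpp_mus_gt0 H s.
Let mu_gt0 := acpp_mu_gt0 H.

Lemma acd_p_ge0 i : 0 <= acd_p Lt s i.
Proof. exact/ltW/acd_p_gt0. Qed.

Let p_sum := acd_p_sum s Lt_gt0.

Definition outer om k : bvec R d := acpp opt f L mu s t (table om) x0 k.

Definition inner om k j : bvec R d * bvec R d :=
  acd_iter opt (F (outer om k)) Lt s mus (table om k) (outer om k) j.

Lemma outer_next om k : outer om k.+1 = (inner om k t).1.
Proof. by []. Qed.

Lemma outer_upd om (k : 'I_K.+1) (j : 'I_t) i :
  outer (ffupd om (k, j) i) k = outer om k.
Proof.
apply: acpp_local => k' j' k'k _; rewrite table_upd.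
by rewrite (ltn_eqF k'k).
Qed.

Lemma inner_upd om (k : 'I_K.+1) (j : 'I_t) i :
  inner (ffupd om (k, j) i) k j.+1 =
  acd_step opt (F (outer om k)) Lt s mus i (inner om k j).
Proof.
rewrite /inner outer_upd /= table_upd !eqxx /=; congr acd_step.
by apply: acd_iter_local => j' jj; rewrite table_upd (ltn_eqF jj) andbF.
Qed.

Definition potential om k j : R :=
  let: c := outer om k in let: wz := inner om k j in
  F c wz.1 - F c (prox c) + mus / 2 * wdot Lt s (prox c - wz.2) (prox c - wz.2).

Lemma mean_potential_step (k : 'I_K.+1) (j : 'I_t) :
  mean (fun om => potential om k j.+1) <=
  (1 - a) * mean (fun om => potential om k j).
Proof.
rewrite -iid_meanZ (iid_mean_resample p_sum (k, j)).
apply: le_iid_mean => om; first exact: acd_p_ge0.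
rewrite /potential; case E : (inner om k j) => [w z].
apply: le_trans (acd_step_contraction Lt_gt0 mus_gt0 opt w z (prox (outer om k))
  (@proxf_block_descent _ _ _ _ _ _ _ _ H (outer om k))
  (proxf_wconvex H s_ge0 _)).
by apply: ler_sum => i _; rewrite outer_upd inner_upd E.
Qed.

Lemma acpp_eta_in : 0 < a < 1.
Proof. by rewrite acd_alpha_gt0 // acd_alpha_lt1. Qed.

(** The contraction factor [1 - eta] accumulates to [lambda]; the 2
    bounds the ratio of the initial potential to the gap. *)
Lemma mean_inner_error (k : nat) : (k <= K)%N ->
  mean (fun om =>
    F (outer om k) (outer om k.+1) - F (outer om k) (prox (outer om k)))
  <= 2 * lambda * mean (fun om => gap (outer om k)).
Proof.
move=> kK; have /andP[a0 a1] := acpp_eta_in.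
have contr j : (j <= t)%N -> mean (fun om => potential om k j) <=
    (1 - a) ^+ j * mean (fun om => potential om k 0).
  elim: j => [|j IH] jt; first by rewrite expr0 mul1r.
  have := mean_potential_step (Ordinal (kK : (k < K.+1)%N)) (Ordinal jt).
  move=> /= /le_trans; apply; rewrite exprS -mulrA ler_pM2l ?subr_gt0 //.
  exact: IH (ltnW jt).
apply: (@le_trans _ _ (mean (fun om => potential om k t))).
  apply: le_iid_mean => om; first exact: acd_p_ge0.
  by rewrite outer_next lerDl mulr_ge0 ?wdot_ge0 // divr_ge0 // ltW.
apply: (le_trans (contr t (leqnn t))); rewrite -/lambda.
rewrite (mulrC 2) -mulrA ler_wpM2l ?exprn_ge0 ?subr_ge0 ?(ltW a1) //.
rewrite -iid_meanZ; apply: le_iid_mean => om; first exact: acd_p_ge0.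
exact: (prox_start_le H s_ge0 (outer om k)).
Qed.

Lemma f_outer_next_le om k : f (outer om k.+1) <=
  F (outer om k) (outer om k.+1) - F (outer om k) (prox (outer om k))
  + (f (outer om k) - gap (outer om k)).
Proof.
have : f (outer om k.+1) <= F (outer om k) (outer om k.+1).
  by rewrite lerDl mulr_ge0 ?sqr_ge0 // ltW.
by rewrite /prox_gap; lra.
Qed.

Lemma mean_f_next (k : nat) : (k <= K)%N ->
  mean (fun om => f (outer om k.+1)) <= mean (fun om => f (outer om k))
    - (1 - 2 * lambda) * mean (fun om => gap (outer om k)).
Proof.
move=> kK; have := mean_inner_error kK => err.
have : mean (fun om => f (outer om k.+1)) <= mean (fun om =>
  F (outer om k) (outer om k.+1) - F (outer om k) (prox (outer om k))
  + (f (outer om k) + (-1) * gap (outer om k))).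
  apply: le_iid_mean => om; first exact: acd_p_ge0.
  by rewrite mulN1r f_outer_next_le.
rewrite iid_meanD (iid_meanD _ (fun om => f (outer om k))).
by rewrite (iid_meanZ _ (-1) (fun om => gap (outer om k))); lra.
Qed.

(** The first proximal step is compared with [xs], which brings in the distance
    of the starting point; [f x0] itself only enters with the factor [lambda].
*)
Lemma mean_f_first : lambda < 2^-1 ->
  mean (fun om => f (outer om 1)) - f xs <=
  mu * enorm (x0 - xs) ^+ 2 + 2 * lambda * (f x0 - f xs).
Proof.
move=> l2.
have at0 (g : bvec R d -> R) : mean (fun om => g (outer om 0)) = g x0.
  exact: iid_mean_cst p_sum (g x0).
have := mean_f_next (leq0n K); rewrite (at0 f) (at0 gap) => h.
have hg : f x0 - f xs - mu * enorm (x0 - xs) ^+ 2 <= gap x0.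
  have := proxP H x0 xs; rewrite /prox_gap {2}/proxf -(enormN (x0 - xs)) opprB.
  by rewrite -/(prox x0); lra.
have l0 : 0 <= lambda.
  by rewrite exprn_ge0 // subr_ge0 ltW //; have /andP[] := acpp_eta_in.
have e0 : 0 <= mu * enorm (x0 - xs) ^+ 2 by rewrite mulr_ge0 ?sqr_ge0 // ltW.
have : (1 - 2 * lambda) * (f x0 - f xs - mu * enorm (x0 - xs) ^+ 2)
   <= (1 - 2 * lambda) * gap x0 by rewrite ler_wpM2l //; lra.
have : 0 <= lambda * (mu * enorm (x0 - xs) ^+ 2) by rewrite mulr_ge0.
move: h; set G := prox_gap _ _ _; lra.
Qed.

(** The decrease of the mean objective telescopes. *)
Lemma mean_gap_sum : (1 - 2 * lambda) *
  \sum_(1 <= k < K.+1) mean (fun om => gap (outer om k)) <=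
  mean (fun om => f (outer om 1)) - f xs.
Proof.
have tel n : (n <= K)%N -> (1 - 2 * lambda) *
    \sum_(1 <= k < n.+1) mean (fun om => gap (outer om k)) <=
    mean (fun om => f (outer om 1)) - mean (fun om => f (outer om n.+1)).
  elim: n => [|n IH] nK; first by rewrite big_geq // mulr0 subrr.
  rewrite big_nat_recr //= mulrDr.
  have := mean_f_next nK; have := IH (ltnW nK); lra.
apply: (le_trans (tel K (leqnn K))); rewrite lerD2l lerN2.
rewrite -[f xs](@iid_mean_cst _ A _ _ p_sum).
apply: le_iid_mean => om; first exact: acd_p_ge0.
exact: acpp_minimizer H _.
Qed.

Lemma mean_sqr_grad_next (k : nat) : (k <= K)%N ->
  mean (fun om => enorm (grad f (outer om k.+1)) ^+ 2) <=
  (16 * mu ^+ 2 + 8 * lambda * Lg ^+ 2) / mu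
  * mean (fun om => gap (outer om k)).
Proof.
move=> kK.
apply: (@le_trans _ _ (mean (fun om => 16 * mu ^+ 2 / mu * gap (outer om k)
   + 4 * Lg ^+ 2 / mu *
     (F (outer om k) (outer om k.+1) - F (outer om k) (prox (outer om k)))))).
  apply: le_iid_mean => om; first exact: acd_p_ge0.
  rewrite sqr_enorm; apply: (le_trans (sqr_grad_le H (outer om k) _)).
  by rewrite mulrDl (mulrAC _ (gap _)) (mulrAC _ (_ - _) mu^-1).
rewrite iid_meanD (iid_meanZ _ _ (fun om => gap (outer om k))) iid_meanZ.
have : 4 * Lg ^+ 2 / mu * mean (fun om => F (outer om k) (outer om k.+1) -
     F (outer om k) (prox (outer om k))) <=
  4 * Lg ^+ 2 / mu * (2 * lambda * mean (fun om => gap (outer om k))).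
  rewrite ler_wpM2l ?mean_inner_error // divr_ge0 ?(ltW mu_gt0) //.
  by rewrite mulr_ge0 ?sqr_ge0.
lra.
Qed.

Lemma sum_mean_sqr_grad : lambda < 2^-1 ->
  \sum_(1 <= k < K.+1) mean (fun om => enorm (grad f (outer om k.+1)) ^+ 2) <=
  (16 * mu ^+ 2 + 8 * lambda * Lg ^+ 2) / (mu * (1 - 2 * lambda)) *
  (mu * enorm (x0 - xs) ^+ 2 + 2 * lambda * (f x0 - f xs)).
Proof.
move=> l2; have := le_trans mean_gap_sum (mean_f_first l2).
have l0 : 0 <= lambda.
  by rewrite exprn_ge0 // subr_ge0 ltW //; have /andP[] := acpp_eta_in.
set S := \sum_(_ <= k < _) _; set rhs := mu * _ + _ => hS.
set c := 16 * mu ^+ 2 + 8 * lambda * Lg ^+ 2.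
have c0 : 0 <= c by rewrite addr_ge0 // (mulr_ge0 _ (sqr_ge0 _)) // mulr_ge0.
have l20 : 0 < 1 - 2 * lambda by lra.
apply: (@le_trans _ _ (c / mu * S)).
  rewrite /S big_distrr /= !big_nat; apply: ler_sum => k /andP[_ kK].
  exact: mean_sqr_grad_next.
have -> : c / (mu * (1 - 2 * lambda)) * rhs = c / mu * (rhs / (1 - 2 * lambda)).
  by field; rewrite !gt_eqF.
rewrite ler_wpM2l ?divr_ge0 ?(ltW mu_gt0) // ler_pdivlMr //.
by rewrite mulrC.
Qed.

End OuterLoop.

(** * From the probability space to finite sums *)

Lemma expectation_discrete (R : realType) (disp : measure_display)
    (T : measurableType disp) (P : probability T R) (B : finType) (X : T -> B)
    (law g : B -> R) :
  (forall b, 0 <= g b) -> (forall b, measurable [set w | X w = b]) ->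
  (forall b, P [set w | X w = b] = (law b)%:E) ->
  ('E_P[fun w => g (X w)] = (\sum_b law b * g b)%:E)%E.
Proof.
move=> g0 mX PX; rewrite unlock.
transitivity (\int[P]_w (\sum_(b <- index_enum B)
    (g b)%:E * (\1_[set w | X w = b] w)%:E))%E.
  apply: eq_integral => w _; rewrite (bigD1 (X w)) //= big1 => [|b bX].
    by rewrite indicE mem_set // mule1 adde0.
  rewrite indicE memNset ?mule0 // => /= Xb.
  by rewrite Xb eqxx in bX.
rewrite ge0_integral_sum //; last 2 first.
- move=> b; apply: measurable_funeM; apply/measurable_EFinP.
  exact: measurable_indic.
- by move=> b w _; rewrite mule_ge0 ?lee_fin // indicE; case: (_ \in _).
rewrite -sumEFin; apply: eq_bigr => b _.
rewrite ge0_integralZl_EFin //; last first.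
  by apply/measurable_EFinP; exact: measurable_indic.
by rewrite integral_indic // setIT EFinM muleC -PX.
Qed.

Lemma big_option (R : Type) (x : R) (op : Monoid.com_law x) (A : finType)
    (F : option A -> R) :
  \big[op/x]_a F a = op (F None) (\big[op/x]_a F (Some a)).
Proof.
rewrite (bigD1 None) //=; congr (op _ _).
rewrite (reindex_omap Some id) => [|[a|]] //=.
by apply: eq_bigl => a; rewrite eqxx.
Qed.

Section Sampling.
Variables (R : realType) (disp : measure_display) (T : measurableType disp).
Variables (P : probability T R) (m : nat) (p : 'I_m.+1 -> R) (K t : nat).
Variables (I : nat -> nat -> T -> 'I_m.+1) (khat : T -> nat).
Hypothesis S : acpp_sampling P p K t I khat.

Lemma khat_ord_proof w : (khat w - 2 < K)%N.
Proof. have := sampling_output_range S w; lia. Qed.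

(** All the randomness of a run as one variable with values in a finite type.
    The output index is shifted by 2, so that its range starts at 0. *)
Definition run_sample w : {ffun 'I_K.+1 * 'I_t -> 'I_m.+1} * 'I_K :=
  ([ffun kj : 'I_K.+1 * 'I_t => I kj.1 kj.2 w], Ordinal (khat_ord_proof w)).

Definition run_event (u : {ffun 'I_K.+1 * 'I_t -> 'I_m.+1} * 'I_K)
    (b : option ('I_K.+1 * 'I_t)) : set T :=
  if b is Some kj then [set w | I kj.1 kj.2 w = u.1 kj]
  else [set w | khat w = u.2.+2].

Lemma run_sample_eq u : [set w | run_sample w = u] =
  \bigcap_(b in [set` [set: option ('I_K.+1 * 'I_t)]%SET]) run_event u b.
Proof.
case: u => om c; apply/seteqP; split => [w /= [<- <-] [kj|] _ /=|w /= h].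
- by rewrite ffunE.
- by have := sampling_output_range S w; lia.
congr (_, _).
  apply/ffunP => kj; rewrite ffunE.
  by have /= := h (Some kj) (finset.in_setT _).
by apply: val_inj; have /= -> := h None (finset.in_setT _); rewrite subn2.
Qed.

Lemma run_event_in u (b : option ('I_K.+1 * 'I_t)) : match b with
   | Some kj => rv_events (I kj.1 kj.2)
   | None => rv_events khat
   end (run_event u b).
Proof.
by case: b => [kj|] /=; [exists [set u.1 kj]|exists [set (u.2.+2)%N]].
Qed.

Lemma measurable_run_sample u : measurable [set w | run_sample w = u].
Proof.
rewrite run_sample_eq; apply: fin_bigcap_measurable => // b _.
have := run_event_in u b; case: b => [[k j]|] uE.
  have kK : (k <= K)%N by rewrite -ltnS.
  by have mI := sampling_block_rv S kK (ltn_ord j); exact: mI uE.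
by have mk := sampling_output_rv S; exact: mk uE.
Qed.

Lemma run_sample_law u : P [set w | run_sample w = u] =
  (K%:R^-1 * iid_weight p u.1)%:E.
Proof.
rewrite run_sample_eq (sampling_independent S); last first.
  by move=> b _; exact: run_event_in.
under eq_bigl do rewrite inE; rewrite big_option /=.
rewrite (sampling_output_law S); last by rewrite /= !ltnS.
rewrite EFinM; congr (_ * _)%E; rewrite /iid_weight -prodEFin.
apply: eq_bigr => -[k j] _; apply: (sampling_block_law S) => //.
by rewrite -ltnS.
Qed.

Lemma acpp_mean_sqr_gradE (d : 'I_m.+1 -> nat) (f : bvec R d -> R) L mu s opt
    x0 :
  acpp_mean_sqr_grad P opt f L mu s t I khat x0 =
  (K%:R^-1 * \sum_(1 <= k < K.+1) iid_mean p (fun om =>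
     enorm (grad f (outer f L mu opt s x0 (K := K) (t := t) om k.+1)) ^+ 2))%:E.
Proof.
pose g (u : {ffun 'I_K.+1 * 'I_t -> 'I_m.+1} * 'I_K) : R :=
  enorm (grad f (outer f L mu opt s x0 u.1 u.2.+2)) ^+ 2.
transitivity ('E_P[fun w => g (run_sample w)])%E.
  rewrite /acpp_mean_sqr_grad; congr expectation; apply/funext => w; rewrite /g.
  have -> : (run_sample w).2.+2 = khat w.
    by have /= := sampling_output_range S w; lia.
  congr (enorm (grad f _) ^+ 2); apply: acpp_local => k j kk jt.
  have kK : (k < K.+1)%N by have := sampling_output_range S w; lia.
  by rewrite (table_in _ (Ordinal kK) (Ordinal jt)) ffunE.
have g0 u : 0 <= g u by exact: sqr_ge0.
rewrite (expectation_discrete g0 measurable_run_sample run_sample_law).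
congr EFin; rewrite big_add1 /= big_mkord big_distrr /=.
rewrite -(pair_big xpredT xpredT
  (fun om c => K%:R^-1 * iid_weight p om * g (om, c))) /=.
rewrite exchange_big /=; apply: eq_bigr => c _; rewrite /iid_mean big_distrr /=.
by apply: eq_bigr => om _; rewrite -mulrA.
Qed.

End Sampling.

(** * The rate and the number of block updates *)

Section Rate.
Variables (R : realType) (m : nat) (d : 'I_m.+1 -> nat) (f : bvec R d -> R).
Variables (L : 'I_m.+1 -> R) (Lg mu : R) (xs : bvec R d).
Hypothesis H : acpp_assumptions f L Lg mu xs.
Variables (opt : acd_option) (s : R) (x0 : bvec R d).
Hypothesis s_ge0 : 0 <= s.

Let Lt := shiftL L mu.
Let eta := acpp_eta L mu s.
Let kap := kappa Lt s.
Let mu_gt0 := acpp_mu_gt0 H.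
Let Lg_gt0 := acpp_const_gt0 H.
Let kap_ge1 : 1 <= kap := kappa_ge1 s (shiftL_gt0 H).

Lemma objective_gap_ge0 : 0 <= f x0 - f xs.
Proof. by rewrite subr_ge0 (acpp_minimizer H). Qed.

Lemma objective_gap_le : f x0 - f xs <= Lg / 2 * enorm (x0 - xs) ^+ 2.
Proof.
have g0 : grad f xs = 0.
  exact: argmin_grad0 (acpp_block_const_gt0 H)
    (@block_descent _ _ _ _ _ _ _ _ H) (acpp_minimizer H).
have := global_descent H xs x0.
by rewrite g0 dotv0l addr0 sqr_enorm lerBlDl.
Qed.

Section FixedK.
Variables (K t : nat) (disp : measure_display) (T : measurableType disp).
Variables (P : probability T R) (I : nat -> nat -> T -> 'I_m.+1).
Variable khat : T -> nat.
Hypothesis K_ge1 : (1 <= K)%N.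
Hypothesis S : acpp_sampling P (acd_p Lt s) K t I khat.
Let lambda := (1 - eta) ^+ t.

Lemma acpp_lambda_ge0 : 0 <= lambda.
Proof.
by rewrite exprn_ge0 // subr_ge0 ltW //; have /andP[] := acpp_eta_in H s.
Qed.

Lemma acpp_mean_sqr_grad_le : lambda < 2^-1 ->
  (acpp_mean_sqr_grad P opt f L mu s t I khat x0 <=
     ((8 * lambda * Lg ^+ 2 * kap + 16 * mu ^+ 2 * kap)
        / (K%:R * mu * (1 - 2 * lambda))
      * (mu * enorm (x0 - xs) ^+ 2 + 2 * lambda * (f x0 - f xs)))%:E)%E.
Proof.
move=> l2; rewrite (acpp_mean_sqr_gradE S) lee_fin.
have := sum_mean_sqr_grad H opt x0 K s_ge0 l2.
rewrite -/lambda; set M := \sum_(_ <= k < _) _; set rhs := _ + 2 * lambda * _.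
have l0 := acpp_lambda_ge0.
have rhs0 : 0 <= rhs.
  by rewrite addr_ge0 // mulr_ge0 ?sqr_ge0 ?objective_gap_ge0 ?(ltW mu_gt0) //
    mulr_ge0.
set c := 16 * mu ^+ 2 + 8 * lambda * Lg ^+ 2 => hM.
have c0 : 0 <= c by rewrite addr_ge0 // (mulr_ge0 _ (sqr_ge0 _)) // mulr_ge0.
have K0 : 0 < K%:R :> R by rewrite ltr0n.
have l20 : 0 < 1 - 2 * lambda by lra.
set q := c / (mu * (1 - 2 * lambda)) * rhs in hM.
have q0 : 0 <= q by rewrite mulr_ge0 // divr_ge0 // mulr_ge0 ?(ltW l20) ?ltW.
have -> : (8 * lambda * Lg ^+ 2 * kap + 16 * mu ^+ 2 * kap)
  / (K%:R * mu * (1 - 2 * lambda)) * rhs = K%:R^-1 * (kap * q).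
  by rewrite /q /c; field; rewrite !gt_eqF.
rewrite ler_pM2l ?invr_gt0 //; apply: (le_trans hM).
by rewrite ler_peMl.
Qed.

(** The bounds in [acpp_lambdat] give [1 - 2 * lambda >= 3 / 4], a coefficient
    of at most [24 * mu ^+ 2 * kap] and a bracket of at most [5 / 4 * mu * N],
    where [N] is the squared distance; hence the constant 40. *)
Lemma acpp_mean_sqr_grad_le_eps (eps : R) : 0 < eps ->
  lambda <= acpp_lambdat Lg mu ->
  40 * mu ^+ 2 * kap * enorm (x0 - xs) ^+ 2 / eps <= K%:R ->
  (acpp_mean_sqr_grad P opt f L mu s t I khat x0 <= eps%:E)%E.
Proof.
move=> eps0; rewrite /acpp_lambdat !le_min => /and3P[l8 l4 l1].
have l0 := acpp_lambda_ge0.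
have K0 : 0 < K%:R :> R by rewrite ltr0n.
set N := enorm _ ^+ 2; have N0 : 0 <= N by exact: sqr_ge0.
rewrite ler_pdivrMr // => hK.
have l2 : lambda < 2^-1 by lra.
apply: (le_trans (acpp_mean_sqr_grad_le l2)); rewrite lee_fin -/N.
rewrite mulrAC ler_pdivrMr; last by rewrite !mulr_gt0 //; lra.
have lL : lambda * Lg <= mu / 4.
  move: l4; rewrite ler_pdivlMr ?mulr_gt0 //; lra.
have lL2 : lambda * Lg ^+ 2 <= mu ^+ 2.
  by move: l1; rewrite ler_pdivlMr // exprn_gt0.
have rhs_le : mu * N + 2 * lambda * (f x0 - f xs) <= 5 / 4 * mu * N.
  have : 2 * lambda * (f x0 - f xs) <= 2 * lambda * (Lg / 2 * N).
    by rewrite ler_wpM2l ?objective_gap_le // mulr_ge0.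
  have : lambda * Lg * N <= mu / 4 * N by rewrite ler_wpM2r.
  lra.
have c_le :
    8 * lambda * Lg ^+ 2 * kap + 16 * mu ^+ 2 * kap <= 24 * mu ^+ 2 * kap.
  have : lambda * Lg ^+ 2 * kap <= mu ^+ 2 * kap.
    by rewrite ler_wpM2r // (le_trans ler01 kap_ge1).
  lra.
apply: (@le_trans _ _ (24 * mu ^+ 2 * kap * (5 / 4 * mu * N))).
  apply: ler_pM => //.
    have kap0 := le_trans ler01 kap_ge1.
    by rewrite addr_ge0 // mulr_ge0 // (mulr_ge0 _ (sqr_ge0 _)) // mulr_ge0.
  by rewrite addr_ge0 // mulr_ge0 ?sqr_ge0 ?objective_gap_ge0 ?(ltW mu_gt0) //
    mulr_ge0.
have hK' : mu * (3 / 4) * (40 * mu ^+ 2 * kap * N) <=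
    mu * (3 / 4) * (K%:R * eps).
  by rewrite ler_wpM2l // mulr_ge0 ?(ltW mu_gt0).
have : eps * (K%:R * mu) * (3 / 4) <= eps * (K%:R * mu) * (1 - 2 * lambda).
  by rewrite ler_wpM2l ?mulr_ge0 ?(ltW eps0) ?(ltW mu_gt0) //; lra.
lra.
Qed.

End FixedK.

Let lt := acpp_lambdat Lg mu.
Let tmin := acpp_tmin L Lg mu s.

Lemma acpp_lambdat_gt0 : 0 < lt.
Proof.
rewrite /lt /acpp_lambdat !lt_min invr_gt0 ltr0n /=.
by rewrite (divr_gt0 mu_gt0) ?divr_gt0 ?exprn_gt0 ?mulr_gt0.
Qed.

Lemma ln_lambdat_le : ln lt <= -1.
Proof.
have l0 := acpp_lambdat_gt0.
have : lt <= 8^-1 by rewrite ge_min lexx.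
rewrite -[X in _ -> _ <= X](expRK (-1)) => l8.
rewrite ler_ln ?posrE ?expR_gt0 //; apply: (le_trans l8).
(* [8^-1 <= 4^-1 <= expR (-1)] *)
have e : expR (-1) = expR (- 2^-1) ^+ 2 :> R.
  by rewrite -expRM_natl; congr expR; field.
have := expR_ge1Dx (- 2^-1 : R); rewrite e; set r := expR _ => hr.
have r2 : 2^-1 <= r by lra.
have : 2^-1 * 2^-1 <= r * r by apply: ler_pM.
by rewrite expr2; lra.
Qed.

Lemma lambda_le_lambdat t : (tmin <= t)%N -> (1 - eta) ^+ t <= lt.
Proof.
move=> tt; have /andP[e0 e1] := acpp_eta_in H s; have l0 := acpp_lambdat_gt0.
apply: (@le_trans _ _ (expR (- eta) ^+ t)).
  by rewrite lerXn2r ?nnegrE ?expR_ge0 ?expR_ge1Dx // subr_ge0 ltW.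
rewrite -expRM_natl -[X in _ <= X](lnK (l0 : lt \in Num.pos)) ler_expR.
have : - eta^-1 * ln lt <= t%:R.
  apply: (le_trans (ceil_ge _)).
  apply: (@le_trans _ _ (`|Num.ceil (- eta^-1 * ln lt)|%N%:R)); last first.
    by rewrite ler_nat.
  by rewrite natr_absz ler_int ler_norm.
rewrite mulNr -mulrN mulrC ler_pdivrMr //; lra.
Qed.

Lemma tmin_le : tmin%:R <= eta^-1 * - ln lt + 1.
Proof.
have /andP[e0 e1] := acpp_eta_in H s; have ll := ln_lambdat_le.
have x0' : 0 <= - eta^-1 * ln lt.
  by rewrite mulNr -mulrN mulr_ge0 ?invr_ge0 ?(ltW e0) //; lra.
rewrite /tmin /acpp_tmin -/eta -/lt natr_absz ger0_norm ?ceil_ge0 //.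
  have /andP[] := ceil_itv (- eta^-1 * ln lt); rewrite rmorphB /= => h _; lra.
by apply: lt_le_trans x0'; lra.
Qed.

Lemma oppr_ln_lambdat_le :
  - ln lt <= ln (Num.max 8 (Num.max (4 * Lg / mu) (Lg ^+ 2 / mu ^+ 2))).
Proof.
have l0 := acpp_lambdat_gt0; set M := Num.max _ _.
have M0 : 0 < M by rewrite lt_max ltr0n.
have : M^-1 <= lt.
  rewrite !le_min; apply/and3P; split.
  - by rewrite lef_pV2 ?posrE // le_max lexx.
  - rewrite -(invf_div (4 * Lg)) lef_pV2 ?posrE ?divr_gt0 ?mulr_gt0 //.
    by rewrite !le_max lexx orbT.
  - rewrite -(invf_div (Lg ^+ 2)) lef_pV2 ?posrE ?divr_gt0 ?exprn_gt0 //.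
    by rewrite !le_max lexx !orbT.
rewrite -ler_ln ?posrE ?invr_gt0 // lnV ?posrE //; lra.
Qed.

Lemma eta_invE :
  eta^-1 = 1 + acd_T Lt s / Num.sqrt (acpp_mus Lt s mu).
Proof.
rewrite /eta /acpp_eta /acd_alpha invf_div.
by rewrite mulrDl divff // gt_eqF // sqrtr_gt0 (acpp_mus_gt0 H).
Qed.

Lemma eta_inv_le (l : R) : 0 < l -> l <= bmax Lt `^ s ->
  eta^-1 <= Num.max 1 l^-1 *
    (1 + bmax Lt `^ s * acd_T Lt s / Num.sqrt (acpp_mus Lt s mu)).
Proof.
move=> l0 lM; rewrite eta_invE -mulrA; set q := acd_T _ _ / _.
have q0 : 0 <= q.
  by rewrite divr_ge0 ?sqrtr_ge0 // ltW // (acd_T_gt0 _ (shiftL_gt0 H)).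
rewrite mulrDr mulr1 lerD //; first by rewrite le_max lexx.
apply: (@le_trans _ _ (l^-1 * (bmax Lt `^ s * q))).
  by rewrite mulrA ler_peMl // ler_pdivlMl // mulr1.
by rewrite ler_wpM2r ?(mulr_ge0 (powR_ge0 _ _) q0) // le_max lexx orbT.
Qed.

End Rate.
Theorem theorem13 (R : realType) :
  (forall (m : nat) (d : 'I_m.+1 -> nat) (f : bvec R d -> R)
      (L : 'I_m.+1 -> R) (Lg mu : R) (xs : bvec R d),
    acpp_assumptions f L Lg mu xs ->
    forall (opt : acd_option) (s : R) (x0 : bvec R d) (K t : nat),
    0 <= s <= 1 -> (1 <= K)%N ->
    let Lt := shiftL L mu in
    let kappas := kappa Lt s in
    let lambda := (1 - acpp_eta L mu s) ^+ t in
    lambda < 2^-1 ->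
    forall (disp : measure_display) (T : measurableType disp)
      (P : probability T R) (I : nat -> nat -> T -> 'I_m.+1) (khat : T -> nat),
    acpp_sampling P (acd_p Lt s) K t I khat ->
    (acpp_mean_sqr_grad P opt f L mu s t I khat x0 <=
     ((8 * lambda * Lg ^+ 2 * kappas + 16 * mu ^+ 2 * kappas)
        / (K%:R * mu * (1 - 2 * lambda))
      * (mu * enorm (x0 - xs) ^+ 2 + 2 * lambda * (f x0 - f xs)))%:E)%E)
  /\
  (* the constant in O(.) depends on nothing but a positive lower bound l of
     the factor Ltilde_max^s *)
  (forall l : R, 0 < l -> exists2 C : R, 0 < C &
    forall (m : nat) (d : 'I_m.+1 -> nat) (f : bvec R d -> R)
      (L : 'I_m.+1 -> R) (Lg mu : R) (xs : bvec R d),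
    acpp_assumptions f L Lg mu xs ->
    forall (opt : acd_option) (s : R) (x0 : bvec R d),
    0 <= s <= 1 ->
    let Lt := shiftL L mu in
    let kappas := kappa Lt s in
    let tmin := acpp_tmin L Lg mu s in
    l <= bmax Lt `^ s ->
    forall eps : R, 0 < eps ->
    exists K : nat,
      [/\ (1 <= K)%N,
          forall t : nat, (tmin <= t)%N ->
          forall (disp : measure_display) (T : measurableType disp)
            (P : probability T R) (I : nat -> nat -> T -> 'I_m.+1)
            (khat : T -> nat),
          acpp_sampling P (acd_p Lt s) K t I khat ->
          (acpp_mean_sqr_grad P opt f L mu s t I khat x0 <= eps%:E)%E
        & (acpp_block_updates opt tmin K)%:R <=
          C * ((1 + bmax Lt `^ s * acd_T Lt s / Num.sqrt (acpp_mus Lt s mu))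
               * ln (Num.max 8 (Num.max (4 * Lg / mu) (Lg ^+ 2 / mu ^+ 2)))
               * (40 * mu ^+ 2 * kappas * enorm (x0 - xs) ^+ 2 / eps + 1))]).
Proof.
split=> [m d f L Lg mu xs H opt s x0 K t /andP[s0 _] K1 Lt kap lambda l2|l l0].
  move=> disp T P I khat S.
  exact: (acpp_mean_sqr_grad_le H opt x0 s0 K1 S l2).
(* A factor 2 each for the two gradients of Option I, for rounding [tmin] up and
   for the [K + 1] outer iterations; [Num.max 1 l^-1] pays for the factor
   [bmax Lt `^ s] of the stated bound. *)
exists (8 * Num.max 1 l^-1); first by rewrite mulr_gt0 // lt_max ltr01.
move=> m d f L Lg mu xs H opt s x0 /andP[s0 _] Lt kap tmin lM eps eps0.
set A := _ / eps; set h := 1 + _; set M := ln _.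
have A0 : 0 <= A.
  have k0 : 0 <= kap by apply: le_trans (kappa_ge1 s (shiftL_gt0 H)).
  rewrite divr_ge0 ?(ltW eps0) // mulr_ge0 ?sqr_ge0 // mulr_ge0 //.
  by rewrite mulr_ge0 ?sqr_ge0.
exists (Num.trunc A).+1; split=> // [t tt disp T P I khat S|].
  apply: (acpp_mean_sqr_grad_le_eps H opt s0 _ S eps0) => //.
    exact: (lambda_le_lambdat H tt).
  exact/ltW/truncnS_gt.
have M1 : 1 <= M.
  by have := oppr_ln_lambdat_le H; have := ln_lambdat_le H; rewrite -/M; lra.
have /andP[e0 e1] := acpp_eta_in H s.
have ei1 : 1 <= (acpp_eta L mu s)^-1 by rewrite invf_ge1 // ltW.
have t_le : tmin%:R <= 2 * (acpp_eta L mu s)^-1 * M.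
  apply: (le_trans (tmin_le H s)).
  have : (acpp_eta L mu s)^-1 * - ln (acpp_lambdat Lg mu) <=
      (acpp_eta L mu s)^-1 * M.
    by rewrite ler_wpM2l ?invr_ge0 ?(ltW e0) // (oppr_ln_lambdat_le H).
  have : 1 * 1 <= (acpp_eta L mu s)^-1 * M by apply: ler_pM.
  lra.
have K_le : (Num.trunc A).+2%:R <= 2 * (A + 1).
  by have := truncn_le A; rewrite A0 -natr1 -natr1; lra.
rewrite /acpp_block_updates natrM.
have o2 : (if opt is OptionI then 2 else 1)%:R <= 2 :> R.
  by case: (opt); rewrite ler_nat.
apply: (@le_trans _ _ (2 * (2 * (acpp_eta L mu s)^-1 * M * (2 * (A + 1))))).
  by rewrite ler_pM ?ler0n // natrM ler_pM ?ler0n.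
have MA0 : 0 <= M * (A + 1) by rewrite mulr_ge0; lra.
have := ler_wpM2r MA0 (eta_inv_le H l0 lM); rewrite -/h; lra.
Qed.
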